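(* Let $N\ge1$, let $\mathbf{z}=(z_1>\cdots>z_N)$ be a fixed top row and let $\mathbf{a}=(a_1,\ldots,a_N)\in\mathbb{R}^N$ be a fixed perturbation, not depending on $\beta$. For $\beta>0$ let $\{y_i^k(\beta)\}_{1\le i\le k\le N}$ be the perturbed $\beta$-corners process with perturbation $\mathbf{a}$ and fixed top row $\mathbf{z}$. Let $\{\mathsf{y}_i^k\}_{1\le i\le k\le N}$ be the $\infty$-corners lattice with top row $\mathbf{z}$, and let $\{\zeta_i^k\}_{1\le i\le k\le N}$ be the discrete Gaussian Free Field on this lattice. Then, as $\beta\to\infty$: (i) $y_i^k(\beta)\to\mathsf{y}_i^k$ in probability, for all $1\le i\le k\le N$; (ii) the array $\bigl\{\sqrt{\beta}\,(y_i^k(\beta)-\mathsf{y}_i^k)\bigr\}_{1\le i\le k\le N}$ converges in distribution (jointly) to $\{\zeta_i^k\}_{1\le i\le k\le N}$. In particular, the limit is independent of the perturbation $\mathbf{a}$.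
   Context: Interlacing: for $\mathbf{u}=(u_1\ge\cdots\ge u_k)$ and $\mathbf{w}=(w_1\ge\cdots\ge w_{k+1})$, $\mathbf{u}\prec\mathbf{w}$ means $w_1\ge u_1\ge w_2\ge\cdots\ge u_k\ge w_{k+1}$. Perturbed $\beta$-corners process with fixed top row $\mathbf{z}$: a random array with levels $\mathbf{y}^k=(y_1^k\ge\cdots\ge y_k^k)$, $k=1,\ldots,N$, with $\mathbf{y}^N=\mathbf{z}$ deterministic, whose lower levels $\mathbf{Y}=(\mathbf{y}^1,\ldots,\mathbf{y}^{N-1})$ have the probability density (with respect to Lebesgue measure on $\mathbb{R}^{N(N-1)/2}$) proportional, as a function of $\mathbf{Y}$, to $$\mathbf{1}_{\mathbf{y}^1\prec\cdots\prec\mathbf{y}^{N-1}\prec\mathbf{z}}\prod_{k=1}^{N-1}\Bigl(\prod_{1\le i<j\le k}(y_i^k-y_j^k)^{2-\beta}\prod_{p=1}^k\prod_{q=1}^{k+1}|y_p^k-y_q^{k+1}|^{\beta/2-1}\Bigr)\exp\Bigl[\sum_{k=1}^{N-1}\sum_{i=1}^k y_i^k(a_k-a_{k+1})\Bigr].$$ (This is the conditional density of $\mathbf{Y}$ given the top row in the perturbed Gaussian $\beta$-corners process.) $\infty$-corners lattice with top row $\mathbf{z}$: $\mathsf{y}_i^N=z_i$, and for $k=N-1,\ldots,1$ the points $\mathsf{y}_1^k>\cdots>\mathsf{y}_k^k$ are the $k$ roots of the $(N-k)$-th derivative $\left(\frac{d}{du}\right)^{N-k}\prod_{j=1}^N(u-z_j)$.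 Discrete Gaussian Free Field on $\{\mathsf{y}_i^k\}$: the centered Gaussian vector $\{\zeta_i^k\}_{1\le i\le k\le N}$ with $\zeta_i^N=0$ for all $i$ and with the remaining variables having joint density proportional to $$\exp\Bigl(\sum_{k=1}^{N-1}\Bigl[\sum_{1\le i<j\le k}\frac{(\zeta_i^k-\zeta_j^k)^2}{2(\mathsf{y}_i^k-\mathsf{y}_j^k)^2}-\sum_{p=1}^k\sum_{q=1}^{k+1}\frac{(\zeta_p^k-\zeta_q^{k+1})^2}{4(\mathsf{y}_p^k-\mathsf{y}_q^{k+1})^2}\Bigr]\Bigr).$$ The quadratic form in the exponent is known to be negative definite, so this is well defined. *)

(* Defs.v *)
From HB Require Import structures.
From mathcomp Require Import all_boot all_order all_algebra.
From mathcomp Require Import all_classical all_reals all_analysis.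

Set Implicit Arguments.
Unset Strict Implicit.
Unset Printing Implicit Defensive.

Import Order.TTheory GRing.Theory Num.Theory.
Import numFieldNormedType.Exports.

Local Open Scope classical_set_scope.
Local Open Scope ring_scope.

Section cons_measure.
Context d (S : measurableType d) (R : realType).
Variables (m : {sigma_finite_measure set S -> \bar R}) (n : nat).
Variable mu : {sigma_finite_measure set (n.-tuple S) -> \bar R}.

Let cons_pair (x : S * n.-tuple S) : n.+1.-tuple S :=
  [the n.+1.-tuple S of x.1 :: x.2].

Let measurable_cons_pair : measurable_fun [set: S * n.-tuple S] cons_pair.
Proof.
by apply: measurable_cons; [exact: measurable_fst|exact: measurable_snd].
Qed.

Definition cons_measure : set (n.+1.-tuple S) -> \bar R :=
  pushforward (m \x mu)%E cons_pair.

Let cons_measure0 : cons_measure set0 = 0%E.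
Proof. by rewrite /cons_measure /pushforward preimage_set0 measure0. Qed.

Let cons_measure_ge0 A : (0 <= cons_measure A)%E.
Proof. by rewrite /cons_measure /pushforward; exact: measure_ge0. Qed.

Let cons_measure_sigma_additive : semi_sigma_additive cons_measure.
Proof.
move=> F mF tF mUF; rewrite /cons_measure /pushforward preimage_bigcup.
have mc B : measurable B -> measurable (cons_pair @^-1` B).
  by move=> mB; rewrite -[X in measurable X]setTI; exact: measurable_cons_pair.
apply: measure_semi_sigma_additive => [i||].
- exact: mc.
- apply/trivIsetP => /= i j _ _ ij; rewrite -preimage_setI.
  by move/trivIsetP : tF => /(_ _ _ _ _ ij) ->//; rewrite preimage_set0.
- by rewrite -preimage_bigcup; apply: mc.
Qed.

HB.instance Definition _ := isMeasure.Build _ _ _ cons_measure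
  cons_measure0 cons_measure_ge0 cons_measure_sigma_additive.

Let cons_measure_sigma_finite : sigma_finite setT cons_measure.
Proof.
have /sigma_finiteP[F [TF ndF Foo]] := sigma_finiteT m.
have /sigma_finiteP[G [TG ndG Goo]] := sigma_finiteT mu.
pose u (t : n.+1.-tuple S) : S * n.-tuple S := (thead t, [tuple of behead t]).
have uK : cancel cons_pair u by move=> [x t]; congr (_, _); apply/val_inj.
have mu_ : measurable_fun setT u.
  apply/measurable_fun_pair; last exact: measurable_behead.
  exact: measurable_tnth.
exists (fun i => u @^-1` (F i `*` G i)).
  rewrite -preimage_bigcup -[LHS](preimage_setT u); congr preimage.
  rewrite -setXTT TF TG predeqE => -[x y]; split.
    move=> [/= [i _ Fix] [k _ Gky]]; exists (maxn i k) => //; split.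
    - by move: x Fix; exact/subsetPset/ndF/leq_maxl.
    - by move: y Gky; exact/subsetPset/ndG/leq_maxr.
  by move=> [i _ []/= ? ?]; split; exists i.
move=> k; have [? ?] := Foo k; have [? ?] := Goo k; split.
  by rewrite -[X in measurable X]setTI; apply: mu_ => //; exact: measurableX.
rewrite /cons_measure /pushforward (_ : _ @^-1` _ = F k `*` G k).
  by rewrite product_measure1E// lte_mul_pinfty// ge0_fin_numE.
rewrite -comp_preimage (_ : u \o cons_pair = id) ?preimage_id//.
exact/funext/uK.
Qed.

HB.instance Definition _ :=
  Measure_isSigmaFinite.Build _ _ _ cons_measure cons_measure_sigma_finite.

End cons_measure.

(* The n-fold product measure: S^0 is a point of mass 1, and S^(n+1) carries
   the image of the product measure on S * S^n. *)
Fixpoint power_measure d (S : measurableType d) (R : realType)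
    (m : {sigma_finite_measure set S -> \bar R}) n :
    {sigma_finite_measure set (n.-tuple S) -> \bar R} :=
  if n is n'.+1 then cons_measure m (power_measure m n') else \d_[tuple].

Definition lebesgue_tuple {R : realType} n :=
  power_measure (@lebesgue_measure R) n.

Section corners.
Context {R : realType}.

(* Row k of an array has k entries, numbered from 0: y k i is y_(i+1)^k.
   In an array of depth N only the rows 1, ..., N matter. *)
Definition array := forall k, 'I_k -> R.

Definition row_interlace k (u : 'I_k -> R) (w : 'I_k.+1 -> R) :=
  [forall i : 'I_k, w (lift ord0 i) <= u i <= w (widen_ord (leqnSn k) i)].

Definition interlacing N (y : array) :=
  [forall k : 'I_N, (0 < k)%N ==> row_interlace (y k) (y k.+1)].

(* Unnormalized density of the perturbed beta-corners process at y, where row N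
   of y is the top row. For 1 <= k < N, a`_k.-1 is a_k and a`_k is a_(k+1).
   The value of `^ at base 0 only matters on a Lebesgue-null set. *)
Definition corners_weight N (a : N.-tuple R) (beta : R) (y : array) : R :=
  (interlacing N y)%:R *
  (\prod_(1 <= k < N)
     ((\prod_(i < k) \prod_(j < k | (i < j)%N) (y k i - y k j) `^ (2 - beta)) *
      (\prod_(p < k) \prod_(q < k.+1)
          `|y k p - y k.+1 q| `^ (beta / 2 - 1)))) *
  expR (\sum_(1 <= k < N) \sum_(i < k) y k i * (a`_k.-1 - a`_k)).

Definition infty_corners_lattice N (z : N.-tuple R) (y : array) : Prop :=
  (forall i : 'I_N, y N i = tnth z i) /\
  forall k, (1 <= k < N)%N ->
    (forall i j : 'I_k, (i < j)%N -> y k j < y k i) /\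
    (forall x : R,
       root ((\prod_(j < N) ('X - (tnth z j)%:P))^`(N - k)) x <->
       exists i : 'I_k, y k i = x).

Definition dgff_weight N (y zeta : array) : R :=
  expR (\sum_(1 <= k < N)
    (\sum_(i < k) \sum_(j < k | (i < j)%N)
        (zeta k i - zeta k j) ^+ 2 / (2 * (y k i - y k j) ^+ 2) -
     \sum_(p < k) \sum_(q < k.+1)
        (zeta k p - zeta k.+1 q) ^+ 2 / (4 * (y k p - y k.+1 q) ^+ 2))).

(* Positions in the rows 0, ..., N-1 (row 0 is empty): N(N-1)/2 of them. *)
Definition cell N := {k : 'I_N & 'I_k}.

Definition array_cells N (y : array) : {ptws cell N -> R} :=
  fun c => y (tag c) (tagged c).

Definition lower_rows N (y : array) : #|{: cell N}|.-tuple R :=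
  [tuple y (tag (enum_val c)) (tagged (enum_val c)) | c < #|{: cell N}|].

(* The array whose rows below row N are listed by t (a right inverse of
   lower_rows) and whose row N is top; rows above N are irrelevant. *)
Definition assemble N (top : N.-tuple R) (t : #|{: cell N}|.-tuple R) : array :=
  fun k i =>
    if @idP (k < N)%N is ReflectT kN
    then tnth t (enum_rank (Tagged (fun l : 'I_N => 'I_l)
                              (i : 'I_(Ordinal kN))))
    else top`_i.

Section random_arrays.
Context d (T : measurableType d) (P : probability T R).

Definition has_array_density N (top : N.-tuple R) (w : array -> R)
    (Y : T -> array) : Prop :=
  [/\ forall k (i : 'I_k), (k <= N)%N ->
        measurable_fun [set: T] (fun x => Y x k i),
      forall x (i : 'I_N), Y x N i = tnth top i &
      exists2 c : R, 0 < c &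
        forall A : set (#|{: cell N}|.-tuple R), measurable A ->
          P [set x | A (lower_rows N (Y x))] =
          (\int[lebesgue_tuple #|{: cell N}|]_(t in A)
             (c * w (assemble top t))%:E)%E].

Definition perturbed_corners N (z a : N.-tuple R) (beta : R) :=
  has_array_density z (corners_weight a beta).

(* The exponent in dgff_weight being a quadratic form in zeta when row N is 0,
   the rows below form a centered Gaussian vector. *)
Definition dgff N (y : array) :=
  has_array_density [tuple of nseq N 0] (dgff_weight N y).

End random_arrays.

Section convergence.
Context (d : R -> measure_display) (T : forall b, measurableType (d b)).
Variable P : forall b, probability (T b) R.

Definition cvg_in_probability (X : forall b, T b -> R) (l : R) : Prop :=
  forall eps : R, 0 < eps ->
    P b [set x | eps <= `|X b x - l|] @[b --> +oo] --> 0%E.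

Definition cvg_in_distribution (V : topologicalType)
    (X : forall b, T b -> V) d' (T' : measurableType d')
    (P' : probability T' R) (X' : T' -> V) : Prop :=
  forall f : V -> R, continuous f -> (exists M, forall v, `|f v| <= M) ->
    'E_(P b)[f \o X b]%E @[b --> +oo] --> 'E_P'[f \o X']%E.

End convergence.

End corners.
Arguments array R : clear implicits.
Arguments array_cells {R} N y.

(* Main.v *)
From HB Require Import structures.
Require Import Defs.
From mathcomp Require Import all_boot all_order all_algebra.
From mathcomp Require Import all_classical all_reals all_analysis.
From mathcomp Require Import measurable_realfun ring lra zify.
From mathcomp Require polyrcf.

(** For beta > 2 the weight of the corners process is, on the interlacing region,
    Phi^((beta - 2) / 2) times the exponential of a linear function, where the
    interaction [Phi] does not depend on beta ([corners_weightE]). The theorem is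
    Laplace's method for this integrand, and the point is to understand the maximum
    of [Phi] well enough.

    Let u and w be consecutive rows and let U, W be the monic polynomials with these
    roots. The numbers m_q = U(w_q) / W'(w_q) are nonnegative by interlacing, and they
    sum to 1 by Lagrange interpolation ([bary_ge0], [sum_bary]). The product of the
    distances between u and w is the discriminant of w times the product of the m_q,
    so that [Phi] telescopes to the discriminant of the top row times the product of
    all the weights m_q of all levels ([Phi_telescope]). By the arithmetic-geometric
    inequality it is largest when at each level the weights are equal, which means
    that U is proportional to W': this is the lattice of roots of derivatives
    ([infty_corners_critical]).

    A quantitative form of the inequality ([AMGM_stability]), and the fact that the
    weights and the upper row control the lower row in a Lipschitz way near the
    lattice ([root_stability]), give

      Phi Y <= Phi y * exp (- c |Y - y|^2)

    on the whole interlacing region ([Phi_gauss_bound]). After zooming in on the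
    lattice y at scale 1 / sqrt beta this bounds the densities by one Gaussian
    function ([corners_ratio_le]).

    For the pointwise limit, moving y by tau / sqrt beta multiplies each gap by
    1 + v / sqrt beta, where v is a relative displacement. The terms of first order in
    the logarithm of [Phi] cancel because y is a maximum ([gap_sum_critical]), and the
    terms of second order are the exponent of the Gaussian free field. The linear
    function only contributes a factor exp (O (1 / sqrt beta)), which is why the
    perturbation is not seen in the limit ([cvg_corners_ratio]).

    Dominated convergence then shows that expectations of bounded functions of the
    rescaled array converge to those of the free field; normalizing constants are
    never computed, as expectations are quotients of two integrals
    ([cvg_rescaled_expectation]). Convergence in distribution is the case of a
    continuous function, and convergence in probability the case of the indicator
    functions of the events that a coordinate of the rescaled array exceeds
    eps sqrt beta. *)

Import Order.TTheory GRing.Theory Num.Theory.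
Import numFieldNormedType.Exports.

Local Open Scope classical_set_scope.
Local Open Scope ring_scope.

(** * Barycentric weights of interlacing rows *)
Lemma size_prod_ord_XsubC (F : idomainType) k (u : 'I_k -> F) :
  size (\prod_(p < k) ('X - (u p)%:P)) = k.+1.
Proof. by rewrite size_prod_XsubC [index_enum _]unlock -enumT size_enum_ord. Qed.

Lemma coef_prod_ord_XsubC (F : idomainType) k (u : 'I_k -> F) :
  (\prod_(p < k) ('X - (u p)%:P))`_k = 1.
Proof.
rewrite -[RHS](monicP (monic_prod_XsubC (index_enum 'I_k) predT u)) lead_coefE.
by rewrite size_prod_ord_XsubC.
Qed.

(** With U and W the monic polynomials with roots u and w, this is
    U(w_q) / W'(w_q), the residue of U / W at w_q. Pairing u_p with
    w_(lift q p) is possible because lift q enumerates the indices other than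
    q; under interlacing it makes every single factor nonnegative. *)
Definition bary (F : fieldType) k (w : 'I_k.+1 -> F) (u : 'I_k -> F) q : F :=
  \prod_(p < k) ((w q - u p) / (w q - w (lift q p))).
Arguments bary {F k} w u q.

(** Lagrange interpolation of the polynomial with roots u at the points w: both
    sides have degree at most k and agree at the k + 1 distinct points w_q. *)
Lemma lagrange_bary (F : fieldType) k (w : 'I_k.+1 -> F) (u : 'I_k -> F) :
  injective w ->
  \prod_(p < k) ('X - (u p)%:P) =
  \sum_(q < k.+1) bary w u q *: \prod_(p < k) ('X - (w (lift q p))%:P).
Proof.
move=> w_inj; apply/eqP; rewrite -subr_eq0; apply/eqP.
set D := _ - _.
apply: (@roots_geq_poly_eq0 _ _ [seq w q | q <- enum 'I_k.+1]).
- apply/allP => _ /mapP[q _ ->]; apply/rootP.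
  rewrite /D hornerD hornerN horner_prod horner_sum.
  rewrite (bigD1 q)//= hornerZ horner_prod [X in _ - (_ + X)]big1 ?addr0 => [|q' q'q].
    apply/eqP; rewrite subr_eq0; apply/eqP.
    rewrite /bary -big_split/=; apply: eq_bigr => p _; rewrite !hornerXsubC divfK//.
    by rewrite subr_eq0 (inj_eq w_inj) neq_lift.
  rewrite hornerZ horner_prod; have [p qp] := unlift_some q'q.
  rewrite (bigD1 p)//= hornerXsubC qp subrr mul0r mulr0//.
- by rewrite map_inj_uniq// enum_uniq.
- rewrite size_map size_enum_ord (leq_trans (size_polyD _ _))// geq_max.
  rewrite size_prod_ord_XsubC leqnn/= size_polyN.
  apply: (leq_trans (size_sum _ _ _)); apply/bigmax_leqP => q _.
  apply: (leq_trans (size_scale_leq _ _)).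
  by rewrite size_prod_ord_XsubC.
Qed.

Lemma prod_sub_bary (F : fieldType) k (w : 'I_k.+1 -> F) (u : 'I_k -> F) x :
  injective w ->
  \prod_(p < k) (x - u p) =
  \sum_(q < k.+1) bary w u q * \prod_(p < k) (x - w (lift q p)).
Proof.
move=> w_inj; transitivity (\prod_(p < k) ('X - (u p)%:P)).[x].
  by rewrite horner_prod; apply: eq_bigr => p _; rewrite hornerXsubC.
rewrite (lagrange_bary _ _ _ _ w_inj) horner_sum; apply: eq_bigr => q _.
rewrite hornerZ horner_prod; congr (_ * _); apply: eq_bigr => p _.
by rewrite hornerXsubC.
Qed.

(** Leading coefficients in the interpolation formula. *)
Lemma sum_bary (F : fieldType) k (w : 'I_k.+1 -> F) (u : 'I_k -> F) :
  injective w -> \sum_(q < k.+1) bary w u q = 1.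
Proof.
move=> w_inj.
have := congr1 (fun p : {poly F} => p`_k) (lagrange_bary _ _ w u w_inj).
rewrite coef_prod_ord_XsubC coef_sum => ->; apply: eq_bigr => q _.
by rewrite coefZ coef_prod_ord_XsubC mulr1.
Qed.

Lemma row_interlace_noninc (R : realType) k (u : 'I_k -> R) w :
  row_interlace u w -> forall i j : 'I_k.+1, (i <= j)%N -> w j <= w i.
Proof.
move=> /forallP uw i j.
have : forall d (i j : 'I_k.+1), (j = i + d :> nat)%N -> w j <= w i.
  elim => [|d IH] {}i {}j jE; first by rewrite (_ : j = i)//; apply/val_inj; rewrite /= jE addn0.
  have ik : (i < k)%N by have := ltn_ord j; rewrite jE; lia.
  have /andP[h1 h2] := uw (Ordinal ik).
  apply: (le_trans (IH (lift ord0 (Ordinal ik)) j _)).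
    by rewrite jE/= /bump/=; lia.
  apply: (le_trans h1); apply: (le_trans h2).
  by rewrite (_ : widen_ord _ _ = i)//; exact/val_inj.
by move=> /(_ (j - i)%N i j) + ij; apply; rewrite subnKC.
Qed.

(** For p < q both differences in a factor are nonpositive, for p >= q both are
    nonnegative. Together with [sum_bary], interlacing rows below w are thus
    encoded by points of a simplex. *)
Lemma bary_ge0 (R : realType) k (u : 'I_k -> R) w q :
  row_interlace u w -> 0 <= bary w u q.
Proof.
move=> uw; have w_noninc := row_interlace_noninc _ _ _ _ uw.
apply: prodr_ge0 => p _; have /forallP/(_ p)/andP[h1 h2] := uw.
have [pq|qp] := ltnP p q.
  rewrite -mulrNN -invrN mulr_ge0 ?invr_ge0// oppr_ge0 subr_le0.
    by apply: le_trans h1; apply: w_noninc; rewrite /= /bump.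
  by apply: w_noninc; rewrite /= /bump; lia.
apply: divr_ge0; rewrite subr_ge0.
  by apply: (le_trans h2); apply: w_noninc.
by apply: w_noninc; rewrite /= /bump; lia.
Qed.

Definition disc (F : realFieldType) k (w : 'I_k -> F) : F :=
  \prod_(i < k) \prod_(j < k | (i < j)%N) (w i - w j) ^+ 2.
Arguments disc {F k} w.

Lemma disc_ge0 (F : realFieldType) k (w : 'I_k -> F) : 0 <= disc w.
Proof. by do 2![apply: prodr_ge0 => ? _]; exact: sqr_ge0. Qed.

Lemma disc_neq0_inj (F : realFieldType) k (w : 'I_k -> F) :
  disc w != 0 -> injective w.
Proof.
move=> dw0 i j wij; apply/eqP; apply: contraNT dw0.
have key (a b : 'I_k) : (a < b)%N -> w a = w b -> disc w == 0.
  move=> ab wab; apply/prodf_eq0; exists a => //.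
  by apply/prodf_eq0; exists b => //; rewrite wab subrr expr0n.
by rewrite neq_ltn => /orP[ij|ji]; [exact: key ij _|exact: key ji _].
Qed.

Lemma inj_disc_neq0 (F : realFieldType) k (w : 'I_k -> F) :
  injective w -> disc w != 0.
Proof.
move=> w_inj; apply/prodf_neq0 => i _; apply/prodf_neq0 => j ij.
by rewrite expf_neq0// subr_eq0 (inj_eq w_inj) -val_eqE neq_ltn ij.
Qed.

Lemma prod_lift (F : comRingType) k (q : 'I_k.+1) (f : 'I_k.+1 -> F) :
  \prod_(p < k) f (lift q p) = \prod_(j < k.+1 | j != q) f j.
Proof.
rewrite [RHS]big_mkcond (bigD1_ord q)//= eqxx mul1r.
by apply: eq_bigr => p _; rewrite eq_sym neq_lift.
Qed.

Lemma prod_lift_disc (F : realFieldType) k (w : 'I_k.+1 -> F) :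
  \prod_(q < k.+1) \prod_(p < k) `|w q - w (lift q p)| = disc w.
Proof.
under eq_bigr do rewrite (prod_lift _ _ _ (fun j => `|w _ - w j|)).
transitivity ((\prod_(q < k.+1) \prod_(j < k.+1 | (q < j)%N) `|w q - w j|) *
    \prod_(q < k.+1) \prod_(j < k.+1 | (j < q)%N) `|w q - w j|).
  rewrite -big_split; apply: eq_bigr => q _ /=.
  rewrite (bigID (fun j : 'I_k.+1 => (q < j)%N))/=; congr (_ * _).
    by apply: eq_bigl => j; rewrite -val_eqE/=; lia.
  by apply: eq_bigl => j; rewrite -val_eqE/=; lia.
rewrite [X in _ * X](exchange_big_dep predT)//= -big_split.
apply: eq_bigr => q _ /=; rewrite -big_split; apply: eq_bigr => j _ /=.
by rewrite [X in _ * X]distrC -expr2 real_normK// num_real.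
Qed.

(** In the encoding of the lower row by barycentric weights the interaction
    between two consecutive rows is the product of the weights, up to the
    discriminant of the upper row. *)
Lemma prod_dist_bary (R : realType) k (u : 'I_k -> R) w :
  row_interlace u w -> injective w ->
  \prod_(p < k) \prod_(q < k.+1) `|u p - w q| =
  disc w * \prod_(q < k.+1) bary w u q.
Proof.
move=> uw w_inj; rewrite exchange_big/= -prod_lift_disc -big_split.
apply: eq_bigr => q _ /=; rewrite -[bary _ _ _]ger0_norm ?bary_ge0//.
rewrite /bary normr_prod -big_split; apply: eq_bigr => p _ /=.
rewrite normrM normfV mulrC divfK; first by rewrite distrC.
by rewrite normr_eq0 subr_eq0 (inj_eq w_inj) neq_lift.
Qed.

(** * Quantitative AM-GM inequality and stability of roots *)

(** The arithmetic-geometric inequality with a quadratic gain. Writing x = r^2,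
    the bound r <= exp (r - 1) gives x <= exp (2 (r - 1)), and
    2 (r - 1) = (x - 1) - (r - 1)^2, where (r - 1)^2 = ((x - 1) / (r + 1))^2 is
    at least a constant times (x - 1)^2 as long as x is bounded by m. The terms
    x - 1 sum to zero. *)
Lemma AMGM_stability (R : realType) m (x : 'I_m -> R) :
  (forall q, 0 <= x q) -> \sum_q x q = m%:R ->
  \prod_q x q <= expR (- ((2 * m.+1%:R)^-1 * \sum_q (x q - 1) ^+ 2)).
Proof.
move=> x0 sx.
have xm q : x q <= m%:R by rewrite -sx (bigD1 q)//= lerDl sumr_ge0.
have key q : x q <= expR (x q - 1 - (2 * m.+1%:R)^-1 * (x q - 1) ^+ 2).
  pose r := Num.sqrt (x q); have r0 : 0 <= r by exact: sqrtr_ge0.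
  have xE : x q = r ^+ 2 by rewrite sqr_sqrtr.
  have rm : r ^+ 2 <= m%:R by rewrite -xE.
  apply: (@le_trans _ _ (expR (2 * (r - 1)))).
    rewrite xE mulr2n mulrDl mul1r expRD -expr2 lerXn2r ?nnegrE ?expR_ge0//.
    by apply: le_trans (expR_ge1Dx (r - 1)); rewrite addrCA subrr addr0.
  rewrite ler_expR xE.
  have -> : r ^+ 2 - 1 - (2 * m.+1%:R)^-1 * (r ^+ 2 - 1) ^+ 2 =
     2 * (r - 1) + (r - 1) ^+ 2 * (1 - (2 * m.+1%:R)^-1 * (r + 1) ^+ 2) by ring.
  rewrite lerDl mulr_ge0 ?sqr_ge0// subr_ge0 ler_pdivrMl ?mulr1 ?mulr_gt0//.
  rewrite -natr1; have := sqr_ge0 (r - 1); nra.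
apply: (@le_trans _ _ (\prod_q expR (x q - 1 - (2 * m.+1%:R)^-1 * (x q - 1) ^+ 2))).
  by apply: ler_prod => q _; rewrite x0 key.
rewrite -expR_sum ler_expR big_split/= sumrN -mulr_sumr big_split/= sx.
by rewrite sumr_const card_ord mulNrn subrr sub0r.
Qed.

Lemma prod_dist_le (R : realFieldType) n (a b : 'I_n -> R) (M v : R) :
  1 <= M -> 0 <= v -> (forall i, `|a i| <= M) -> (forall i, `|b i| <= M) ->
  (forall i, `|a i - b i| <= v) ->
  `|\prod_i a i - \prod_i b i| <= n%:R * M ^+ n * v.
Proof.
move=> M1 v0; have M0 : 0 <= M by exact: le_trans M1.
elim: n a b => [|n IH] a b aM bM abv.
  by rewrite !big_ord0 subrr normr0 !mul0r.
rewrite !big_ord_recl.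
set A := \prod_(i < n) a _; set B := \prod_(i < n) b _.
have AB : `|A - B| <= n%:R * M ^+ n * v by exact: IH.
have BM : `|B| <= M ^+ n.
  rewrite normr_prod -[X in M ^+ X]card_ord -prodr_const.
  by apply: ler_prod => i _; rewrite normr_ge0 bM.
have -> : a ord0 * A - b ord0 * B = a ord0 * (A - B) + (a ord0 - b ord0) * B by ring.
apply: (le_trans (ler_normD _ _)); rewrite !normrM.
apply: (@le_trans _ _ (M * (n%:R * M ^+ n * v) + v * M ^+ n)).
  by apply: lerD; apply: ler_pM.
have -> : M * (n%:R * M ^+ n * v) + v * M ^+ n = (n%:R * M + 1) * (M ^+ n * v) by ring.
have -> : n.+1%:R * M ^+ n.+1 * v = (n%:R * M + M) * (M ^+ n * v).
  by rewrite -natr1 exprS; ring.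
by rewrite ler_wpM2r ?lerD2l// mulr_ge0// exprn_ge0.
Qed.

(** The harmonic sum gives a positive lower bound of finitely many positive
    numbers without singling out the case of an empty family. *)
Lemma pos_lower_bound (R : realFieldType) (I : finType) (f : I -> R) :
  (forall i, 0 < f i) -> exists2 e : R, 0 < e <= 1 & forall i, e <= f i.
Proof.
move=> f0; pose S := 1 + \sum_i (f i)^-1.
have S1 : 1 <= S by rewrite lerDl sumr_ge0// => i _; rewrite invr_ge0 ltW.
have S0 : 0 < S by exact: lt_le_trans S1.
exists S^-1; first by rewrite invr_gt0 S0 invf_le1.
move=> i; rewrite invf_ple ?posrE// /S (bigD1 i)//= addrCA lerDl.
by rewrite addr_ge0// sumr_ge0// => j _; rewrite invr_ge0 ltW.
Qed.

(** If the weights of (u, w) are all close to 1 / (k + 1) and w is close to w0,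
    then u is close to the critical points u0 of the polynomial with roots w0.
    Interpolation writes U(u0_j) as a Lipschitz function of the weights and of w
    which vanishes at the reference configuration, so |U(u0_j)| <= D v. By
    interlacing, the factors of U(u0_j) other than u0_j - u_j stay away from zero
    as long as w moves by less than half the gap between w0 and u0, which bounds
    |u0_j - u_j|. For larger moves the a priori bound B is enough. The estimate
    is therefore global, although roots are not globally Lipschitz functions of
    the coefficients. *)
Lemma root_stability (R : realType) k (w0 : 'I_k.+1 -> R) (u0 : 'I_k -> R) (B : R) :
  1 <= B ->
  (forall i, w0 (lift ord0 i) < u0 i < w0 (widen_ord (leqnSn k) i)) ->
  (forall j, \sum_(q < k.+1) \prod_(p < k) (u0 j - w0 (lift q p)) = 0) ->
  (forall q, `|w0 q| <= B) -> (forall p, `|u0 p| <= B) ->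
  exists2 C : R, 0 <= C &
  forall (w : 'I_k.+1 -> R) (u : 'I_k -> R) (v : R),
    row_interlace u w -> injective w ->
    (forall q, `|w q| <= B) -> (forall p, `|u p| <= B) -> 0 <= v ->
    (forall q, `|k.+1%:R * bary w u q - 1| <= v) ->
    (forall q, `|w q - w0 q| <= v) ->
    forall j, `|u j - u0 j| <= C * v.
Proof.
move=> B1 gap crit w0B u0B.
have w0_noninc : forall i j : 'I_k.+1, (i <= j)%N -> w0 j <= w0 i.
  apply: (@row_interlace_noninc _ _ u0); apply/forallP => i.
  by have /andP[? ?] := gap i; rewrite !ltW.
have [e /andP[e0 e1] He] := @pos_lower_bound R _
  (fun i => Num.min (u0 i - w0 (lift ord0 i)) (w0 (widen_ord (leqnSn k) i) - u0 i))
  (fun i => ltac:(by have /andP[? ?] := gap i; rewrite lt_min !subr_gt0; apply/andP)).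
(* Half a lower bound of all gaps: moving w by h leaves a distance h to u0. *)
pose h := e / 2.
have h0 : 0 < h by rewrite divr_gt0.
have h1 : h <= 1 by rewrite /h; lra.
pose M := 2 * B; have M1 : 1 <= M by rewrite /M; lra.
pose D := k.+1%:R * M ^+ k + k%:R * M ^+ k.
have M0 : 0 <= M by lra.
have D0 : 0 <= D by rewrite addr_ge0// mulr_ge0// exprn_ge0.
exists (D / h ^+ k + M / h).
  by rewrite addr_ge0// divr_ge0// ?exprn_ge0// ltW.
move=> w u v uw w_inj wB uB v0 mv wv j.
have distM (x y : R) : `|x| <= B -> `|y| <= B -> `|x - y| <= M.
  by move=> xB yB; apply: (le_trans (ler_normB _ _)); rewrite /M; lra.
rewrite mulrDl; have [hv|vh] := leP h v.
  apply: ler_wpDl; first by rewrite !mulr_ge0// invr_ge0 exprn_ge0// ltW.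
  apply: (le_trans (distM _ _ (uB j) (u0B j))).
  by rewrite -mulrA ler_peMr// ler_pdivlMl// mulr1.
apply: ler_wpDr; first by rewrite mulr_ge0// divr_ge0// ltW.
have k0 : 0 < k.+1%:R :> R by rewrite ltr0n.
have TD : `|\prod_(p < k) (u0 j - u p)| <= D * v.
  rewrite (prod_sub_bary _ _ w u _ w_inj).
  pose A (q : 'I_k.+1) := \prod_(p < k) (u0 j - w (lift q p)).
  pose A0 (q : 'I_k.+1) := \prod_(p < k) (u0 j - w0 (lift q p)).
  have -> : \sum_(q < k.+1) bary w u q * \prod_(p < k) (u0 j - w (lift q p)) =
    \sum_(q < k.+1) (bary w u q - k.+1%:R^-1) * A q +
    k.+1%:R^-1 * \sum_(q < k.+1) (A q - A0 q).
    rewrite sumrB crit subr0 mulr_sumr -big_split; apply: eq_bigr => q _ /=.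
    by rewrite mulrBl subrK.
  apply: (le_trans (ler_normD _ _)); rewrite /D mulrDl lerD//.
    apply: (le_trans (ler_norm_sum _ _ _)).
    apply: (@le_trans _ _ (\sum_(q < k.+1) M ^+ k * v)); last first.
      by rewrite sumr_const card_ord -[leLHS]mulr_natl mulrA.
    apply: ler_sum => q _; rewrite normrM mulrC; apply: ler_pM => //.
      rewrite /A normr_prod -[X in M ^+ X]card_ord -prodr_const.
      by apply: ler_prod => p _; rewrite normr_ge0 distM.
    have -> : bary w u q - k.+1%:R^-1 =
        k.+1%:R^-1 * (k.+1%:R * bary w u q - 1).
      by rewrite mulrBr mulKf ?gt_eqF// mulr1.
    rewrite normrM ger0_norm ?invr_ge0//.
    apply: (le_trans _ (mv q)); rewrite ler_piMl// invf_le1// ler1n//.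
  rewrite normrM ger0_norm ?invr_ge0//.
  rewrite ler_pdivrMl//; apply: (le_trans (ler_norm_sum _ _ _)).
  apply: (@le_trans _ _ (\sum_(q < k.+1) k%:R * M ^+ k * v)); last first.
    by rewrite sumr_const card_ord -[leLHS]mulr_natl.
  apply: ler_sum => q _; apply: prod_dist_le => // p; [exact: distM|exact: distM|].
  rewrite (_ : _ - _ = w0 (lift q p) - w (lift q p)); last by ring.
  by rewrite distrC.
rewrite mulrAC ler_pdivlMr ?exprn_gt0//; apply: le_trans TD.
rewrite normr_prod (bigD1 j)//= distrC ler_wpM2l//.
rewrite -[X in h ^+ X]card_ord -prodr_const (bigD1 j)//=.
rewrite -[leRHS]mul1r; apply: ler_pM => //; first exact: ltW.
  by apply: prodr_ge0 => *; exact: ltW.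
apply: ler_prod => p pj; rewrite (ltW h0)/=.
have /andP[up1 up2] : w (lift ord0 p) <= u p <= w (widen_ord (leqnSn k) p).
  by have /forallP := uw.
have := He j; rewrite le_min => /andP[e_lo e_hi].
have e2h : e = 2 * h by rewrite /h; field.
have [pj'|pj'] := ltnP p j.
  rewrite distrC; apply: le_trans (ler_norm _).
  have := wv (lift ord0 p); rewrite ler_norml => /andP[wv1 _].
  have := w0_noninc (lift ord0 p) (widen_ord (leqnSn k) j) pj'.
  lra.
apply: le_trans (ler_norm _).
have := wv (widen_ord (leqnSn k) p); rewrite ler_norml => /andP[_ wv1].
have jp : (lift ord0 j <= widen_ord (leqnSn k) p)%N.
  by rewrite /= /bump/= add1n ltn_neqAle pj' andbT eq_sym.
have := w0_noninc _ _ jp.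
lra.
Qed.

(** * The lattice of derivative roots *)

(** The difference of the two sides has degree less than k, because the leading
    terms cancel, and it vanishes at k distinct points. *)
Lemma deriv_monic_roots (F : numFieldType) k (w : 'I_k.+1 -> F) (u : 'I_k -> F) :
  injective u ->
  (forall i, root (\prod_(q < k.+1) ('X - (w q)%:P))^`() (u i)) ->
  (\prod_(q < k.+1) ('X - (w q)%:P))^`() =
  k.+1%:R *: \prod_(p < k) ('X - (u p)%:P).
Proof.
move=> u_inj ru; apply/eqP; rewrite -subr_eq0; apply/eqP.
set W := \prod_(q < _) _; set V := \prod_(p < _) _.
apply: (@roots_geq_poly_eq0 _ _ [seq u p | p <- enum 'I_k]).
- apply/allP => _ /mapP[p _ ->]; apply/rootP.
  rewrite hornerD hornerN hornerZ (rootP (ru p)) sub0r horner_prod (bigD1 p)//=.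
  by rewrite hornerXsubC subrr mul0r mulr0 oppr0.
- by rewrite map_inj_uniq// enum_uniq.
- rewrite size_map size_enum_ord; apply/leq_sizeP => j; rewrite leq_eqVlt.
  rewrite coefB coef_deriv coefZ => /predU1P[<-|kj].
    by rewrite !coef_prod_ord_XsubC mulr1 subrr.
  rewrite nth_default ?mul0rn ?sub0r; last by rewrite size_prod_ord_XsubC.
  by rewrite nth_default ?mulr0 ?oppr0// size_prod_ord_XsubC.
Qed.

Lemma horner_deriv_prod_XsubC (F : comNzRingType) k (w : 'I_k.+1 -> F) q :
  (\prod_(j < k.+1) ('X - (w j)%:P))^`().[w q] =
  \prod_(p < k) (w q - w (lift q p)).
Proof.
rewrite (bigD1_ord q)//= derivM derivXsubC mul1r hornerD hornerM hornerXsubC.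
rewrite subrr mul0r addr0 horner_prod.
by apply: eq_bigr => p _; rewrite hornerXsubC.
Qed.

(** If U = W' / (k + 1) then the residue U(w_q) / W'(w_q) is 1 / (k + 1): rows of
    derivative roots are the barycentres of the simplices of weights. *)
Lemma bary_derivative (F : numFieldType) k (w : 'I_k.+1 -> F) (u : 'I_k -> F) q :
  injective w ->
  (\prod_(q < k.+1) ('X - (w q)%:P))^`() =
    k.+1%:R *: \prod_(p < k) ('X - (u p)%:P) ->
  bary w u q = k.+1%:R^-1.
Proof.
move=> w_inj /(congr1 (fun p => p.[w q])).
rewrite horner_deriv_prod_XsubC hornerZ horner_prod.
under [X in _ = _ * X -> _]eq_bigr do rewrite hornerXsubC.
have nz : \prod_(p < k) (w q - w (lift q p)) != 0.
  by apply/prodf_neq0 => p _; rewrite subr_eq0 (inj_eq w_inj) neq_lift.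
rewrite /bary prodf_div => E; rewrite E in nz *.
rewrite invfM mulrCA divff ?mulr1//.
by move: nz; rewrite mulf_eq0 negb_or => /andP[].
Qed.

Lemma incr_ord_id k (f : 'I_k -> 'I_k) :
  (forall i j : 'I_k, (i < j)%N -> (f i < f j)%N) -> forall i, f i = i.
Proof.
move=> f_incr.
have lo m (i : 'I_k) : i = m :> nat -> (m <= f i)%N.
  elim: m i => [//|m IH] i iE.
  have mk : (m < k)%N by have := ltn_ord i; lia.
  have := f_incr (Ordinal mk) i; rewrite /= iE ltnSn => /(_ isT).
  by apply: leq_ltn_trans; exact: IH.
have hi m (i : 'I_k) : (i + m).+1 = k -> (f i + m < k)%N.
  elim: m i => [|m IH] i iE; first by rewrite addn0.
  have mk : (i.+1 < k)%N by lia.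
  have h1 := f_incr i (Ordinal mk) (ltnSn _).
  have := IH (Ordinal mk); rewrite /= addSnnS => /(_ iE).
  by apply: leq_ltn_trans; rewrite addnS -addSn leq_add2r.
move=> i; apply/val_inj/eqP; rewrite eqn_leq lo// andbT.
have ik := ltn_ord i.
have /hi : (i + (k - i.+1)).+1 = k by lia.
by move=> /= ?; lia.
Qed.

(** Rolle's theorem puts a root in each of the k gaps of w, so the choice of one
    root per gap is an increasing map from 'I_k to the indices of u; it has to be
    the identity. *)
Lemma derivative_interlaces (R : realType) k (w : 'I_k.+1 -> R) (u : 'I_k -> R) :
  (forall i j : 'I_k.+1, (i < j)%N -> w j < w i) ->
  (forall i j : 'I_k, (i < j)%N -> u j < u i) ->
  (forall x, root (\prod_(q < k.+1) ('X - (w q)%:P))^`() x -> exists i, u i = x) ->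
  forall i, w (lift ord0 i) < u i < w (widen_ord (leqnSn k) i).
Proof.
move=> w_decr u_decr ru.
have u_mono (i j : 'I_k) : u j < u i -> (i < j)%N.
  move=> uji; rewrite ltnNge leq_eqVlt; apply/negP => /predU1P[ij|/u_decr].
    by move: uji; rewrite (val_inj ij) ltxx.
  by move=> /(lt_trans uji); rewrite ltxx.
have w0 q : (\prod_(j < k.+1) ('X - (w j)%:P)).[w q] = 0.
  by rewrite horner_prod (bigD1 q)//= hornerXsubC subrr mul0r.
have /choice[f Hf] : forall i : 'I_k, exists j : 'I_k,
    w (lift ord0 i) < u j < w (widen_ord (leqnSn k) i).
  move=> i.
  have lt_w : w (lift ord0 i) < w (widen_ord (leqnSn k) i).
    by apply: w_decr; rewrite /= /bump.
  have [c] := polyrcf.poly_rolle lt_w (etrans (w0 _) (esym (w0 _))).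
  by rewrite in_itv/= => cI /eqP/ru[j uj]; exists j; rewrite uj.
suff f_id i : f i = i by move=> i; have := Hf i; rewrite f_id.
apply: incr_ord_id => a b ab; apply: u_mono.
have /andP[_ h1] := Hf b; have /andP[h2 _] := Hf a.
apply: (lt_le_trans h1); apply: le_trans (ltW h2).
have : (lift ord0 a <= widen_ord (leqnSn k) b)%N by rewrite /= /bump.
rewrite leq_eqVlt => /predU1P[E|/w_decr/ltW//].
by rewrite (_ : lift ord0 a = widen_ord (leqnSn k) b)//; exact/val_inj.
Qed.

(** What the proof uses of the lattice, in terms of weights instead of
    derivatives. *)
Definition critical (R : realType) N (y : array R) : Prop :=
  [/\ forall k, (0 < k < N)%N -> forall i,
        y k.+1 (lift ord0 i) < y k i < y k.+1 (widen_ord (leqnSn k) i),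
      forall k, (0 < k <= N)%N -> injective (y k) &
      forall k, (0 < k < N)%N -> forall q,
        bary (y k.+1) (y k) q = k.+1%:R^-1].
Arguments critical {R} N y.

Lemma critical_interlacing (R : realType) N (y : array R) :
  critical N y -> interlacing N y.
Proof.
move=> [gap _ _]; apply/forallP => k; apply/implyP => k0.
apply/forallP => i; have kN : (0 < k < N)%N by rewrite k0 ltn_ord.
by have /andP[? ?] := gap k kN i; rewrite !ltW.
Qed.

Lemma infty_corners_critical (R : realType) N (z : N.-tuple R) (y : array R) :
  (forall i j : 'I_N, (i < j)%N -> tnth z j < tnth z i) ->
  infty_corners_lattice z y ->
  critical N y.
Proof.
move=> z_decr [yN yk].
have y_decr k : (0 < k <= N)%N ->
    forall i j : 'I_k, (i < j)%N -> y k j < y k i.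
  move=> /andP[k0]; rewrite leq_eqVlt => /predU1P[kN|kN].
    by rewrite kN => i j ij; rewrite !yN; exact: z_decr.
  by have [|] := yk k; rewrite ?k0.
have y_inj k : (0 < k <= N)%N -> injective (y k).
  move=> kN i j yij; apply/eqP; have [ij|ji|ij] := ltngtP (i : nat) j.
  - by have := y_decr k kN i j ij; rewrite yij ltxx.
  - by have := y_decr k kN j i ji; rewrite yij ltxx.
  - by move/val_inj : ij => ->.
pose P := \prod_(j < N) ('X - (tnth z j)%:P).
pose Q k := \prod_(i < k) ('X - (y k i)%:P).
(* Descending from the top row, each derivative of P is a multiple of the
   monic polynomial of the next row. *)
have PQ d : (d < N)%N -> exists2 c : R, c != 0 & P^`(d) = c *: Q (N - d)%N.
  elim: d => [|d IH] dN.
    exists 1; rewrite ?oner_eq0// scale1r subn0 /=.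
    by apply: eq_bigr => i _; rewrite yN.
  have [c c0 E] := IH (ltnW dN).
  have [k kE] : exists k, (N - d = k.+1)%N by exists (N - d).-1; lia.
  have kE' : (N - d.+1 = k)%N by lia.
  exists (c * k.+1%:R); first by rewrite mulf_neq0// pnatr_eq0.
  rewrite derivnS E derivZ kE kE' -scalerA; congr (_ *: _).
  have k0 : (0 < k < N)%N by lia.
  have [_ rk] := yk k k0.
  apply: deriv_monic_roots; first by apply: y_inj; lia.
  move=> i; have /rk : exists j, y k j = y k i by exists i.
  rewrite (_ : (N - k = d.+1)%N); last by lia.
  by rewrite derivnS E derivZ kE rootZ.
have rE k x : (0 < k < N)%N -> root (Q k.+1)^`() x <-> exists i, y k i = x.
  move=> kN; have [|c c0] := PQ (N - k.+1)%N; first by lia.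
  rewrite (_ : N - (N - k.+1) = k.+1)%N; last by lia.
  have [_ <-] := yk k kN => E.
  rewrite (_ : (N - k = (N - k.+1).+1)%N); last by lia.
  by rewrite derivnS E derivZ rootZ.
split=> // k kN; have k1N : (0 < k.+1 <= N)%N by lia.
  have kN' : (0 < k <= N)%N by lia.
  apply: derivative_interlaces; [exact: y_decr|exact: y_decr|].
  by move=> x /rE; exact.
have kN' : (0 < k <= N)%N by lia.
move=> q; apply: bary_derivative; first exact: y_inj.
apply: deriv_monic_roots; first exact: y_inj.
by move=> i; apply/rE => //; exists i.
Qed.

(** * The maximum of the interaction *)

(** The interaction whose power (beta - 2) / 2 is, up to the linear term, the
    weight of the corners process. Since 0^-1 = 0 it vanishes when a row below
    the top one has coinciding entries, in accordance with 0 to a nonzero real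
    power being 0 in the weight. *)
Definition Phi (R : realType) N (Y : array R) : R :=
  \prod_(1 <= k < N)
    ((disc (Y k))^-1 * \prod_(p < k) \prod_(q < k.+1) `|Y k p - Y k.+1 q|).
Arguments Phi {R} N Y.

Lemma interlacing_row (R : realType) N (Y : array R) k :
  interlacing N Y -> (0 < k < N)%N -> row_interlace (Y k) (Y k.+1).
Proof.
move=> /forallP H /andP[k0 kN].
by have := H (Ordinal kN); rewrite /= k0.
Qed.

Lemma disc1 (R : realType) (w : 'I_1 -> R) : disc w = 1.
Proof. by rewrite /disc big_ord1 big_pred0// => j; rewrite !ord1. Qed.

(** The discriminant of row k + 1 that comes out of [prod_dist_bary] cancels the
    one in the denominator at level k + 1; the discriminant of the top row
    remains. *)
Lemma Phi_telescope (R : realType) N (Y : array R) :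
  (0 < N)%N -> (forall k, (0 < k < N)%N -> row_interlace (Y k) (Y k.+1)) ->
  (forall k, (0 < k <= N)%N -> disc (Y k) != 0) ->
  Phi N Y = disc (Y N) *
    \prod_(1 <= k < N) \prod_(q < k.+1) bary (Y k.+1) (Y k) q.
Proof.
case: N => // N _; elim: N => [|N IH] HY HD.
  by rewrite /Phi !big_geq// disc1 mulr1.
rewrite /Phi big_nat_recr//= -/(Phi N.+1 Y) IH; first last.
- by move=> k kN; apply: HD; lia.
- by move=> k kN; apply: HY; lia.
rewrite [in RHS]big_nat_recr//= prod_dist_bary//; first last.
- by apply/disc_neq0_inj/HD; lia.
- by apply: HY; lia.
have D0 : disc (Y N.+1) != 0 by apply: HD; lia.
by field.
Qed.

Lemma prod_bary_le (R : realType) k (w : 'I_k.+1 -> R) (u : 'I_k -> R) N :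
  row_interlace u w -> injective w -> (k < N)%N ->
  \prod_(q < k.+1) bary w u q <= \prod_(q < k.+1) k.+1%:R^-1 *
    expR (- ((2 * N.+1%:R)^-1 * \sum_(q < k.+1) (k.+1%:R * bary w u q - 1) ^+ 2)).
Proof.
move=> uw w_inj kN.
have k0 : k.+1%:R != 0 :> R by rewrite pnatr_eq0.
under eq_bigr do rewrite -[bary _ _ _](mulKf k0).
rewrite big_split/= ler_wpM2l//.
  by apply: prodr_ge0 => q _; rewrite invr_ge0.
apply: (le_trans (AMGM_stability _ _ _ _ _)).
- by move=> q; rewrite mulr_ge0// bary_ge0.
- by rewrite -mulr_sumr sum_bary// mulr1.
rewrite ler_expR lerN2 ler_wpM2r//; first by apply: sumr_ge0 => q _; exact: sqr_ge0.
by rewrite lef_pV2 ?posrE ?mulr_gt0// ler_pM2l// ler_nat; lia.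
Qed.

(** By telescoping, both sides are products of weights with the same prefactor
    disc (y N), and uniform weights maximize such a product. *)
Lemma Phi_le (R : realType) N (y Y : array R) :
  (0 < N)%N -> interlacing N Y -> (forall i, Y N i = y N i) ->
  critical N y -> (forall k, (0 < k <= N)%N -> disc (Y k) != 0) ->
  Phi N Y <= Phi N y * expR (- ((2 * N.+1%:R)^-1 *
    \sum_(1 <= k < N) \sum_(q < k.+1) (k.+1%:R * bary (Y k.+1) (Y k) q - 1) ^+ 2)).
Proof.
move=> N0 iY YN cy Ydisc; have [_ y_inj ybary] := cy.
have YNy : disc (Y N) = disc (y N).
  by apply: eq_bigr => i _; apply: eq_bigr => j _; rewrite !YN.
rewrite Phi_telescope//; last by move=> k; exact: interlacing_row.
rewrite Phi_telescope//; first last.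
- by move=> k kN; exact/inj_disc_neq0/y_inj.
- by move=> k; apply: interlacing_row; exact: critical_interlacing.
rewrite YNy -mulrA ler_wpM2l ?disc_ge0//.
rewrite mulr_sumr -sumrN expR_sum -big_split/=.
rewrite big_nat [leRHS]big_nat; apply: ler_prod => k /andP[k0 kN].
have k0N : (0 < k < N)%N by rewrite k0.
have ikY : row_interlace (Y k) (Y k.+1) by exact: interlacing_row iY k0N.
rewrite prodr_ge0/=; last by move=> q _; exact: bary_ge0.
under [X in _ <= X * _]eq_bigr do rewrite ybary//.
apply: prod_bary_le => //; apply/disc_neq0_inj/Ydisc; lia.
Qed.

Lemma interlacing_bounded (R : realType) N (Y : array R) (B : R) :
  (forall k, (0 < k < N)%N -> row_interlace (Y k) (Y k.+1)) ->
  (forall i, `|Y N i| <= B) ->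
  forall k, (0 < k <= N)%N -> forall i, `|Y k i| <= B.
Proof.
move=> iY YB.
suff H d : forall k, (0 < k)%N -> (k + d = N)%N -> forall i, `|Y k i| <= B.
  by move=> k /andP[k0 kN]; apply: (H (N - k)%N) => //; rewrite subnKC.
elim: d => [|d IH] k k0 kd; first by rewrite addn0 in kd; rewrite kd.
move=> i; have kN : (0 < k < N)%N by lia.
have /forallP/(_ i)/andP[lo hi] := iY k kN.
have B1 := IH k.+1 isT _ (lift ord0 i); have B2 := IH k.+1 isT _ (widen_ord (leqnSn k) i).
have kd' : (k.+1 + d)%N = N by lia.
move: (B1 kd') (B2 kd'); rewrite !ler_norml => /andP[? ?] /andP[? ?].
by apply/andP; split; lra.
Qed.

(** [root_stability] iterated from the top row, where both arrays agree, down to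
    the first row. *)
Lemma rows_stability (R : realType) N (y : array R) :
  critical N y ->
  exists2 C : R, 0 <= C & forall (Y : array R) (v : R),
    (forall k, (0 < k < N)%N -> row_interlace (Y k) (Y k.+1)) ->
    (forall i, Y N i = y N i) -> (forall k, (0 < k <= N)%N -> injective (Y k)) ->
    0 <= v ->
    (forall k, (0 < k < N)%N -> forall q,
       `|k.+1%:R * bary (Y k.+1) (Y k) q - 1| <= v) ->
    forall k, (0 < k <= N)%N -> forall i, `|Y k i - y k i| <= C * v.
Proof.
move=> cy; have [gap y_inj ybary] := cy.
pose B := 1 + \sum_i `|y N i|.
have B1 : 1 <= B by rewrite lerDl sumr_ge0.
have iy k : (0 < k < N)%N -> row_interlace (y k) (y k.+1).
  by apply: interlacing_row; exact: critical_interlacing.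
have yNB i : `|y N i| <= B.
  by rewrite /B (bigD1 i)//= addrCA lerDl addr_ge0// sumr_ge0.
have yB := interlacing_bounded _ _ _ _ iy yNB.
suff H d : (d < N)%N -> exists2 C : R, 0 <= C & forall (Y : array R) (v : R),
    (forall k, (0 < k < N)%N -> row_interlace (Y k) (Y k.+1)) ->
    (forall i, Y N i = y N i) -> (forall k, (0 < k <= N)%N -> injective (Y k)) ->
    0 <= v ->
    (forall k, (0 < k < N)%N -> forall q,
       `|k.+1%:R * bary (Y k.+1) (Y k) q - 1| <= v) ->
    forall k, (N - d <= k <= N)%N -> forall i, `|Y k i - y k i| <= C * v.
  case: N => [|N] in cy gap y_inj ybary B B1 iy yNB yB H *.
    by exists 0 => // Y v _ _ _ _ _ [].
  have [C C0 HC] := H N (ltnSn _); exists C => // Y v h1 h2 h3 h4 h5 k kN.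
  by apply: HC => //; rewrite subSnn.
elim: d => [|d IH] dN.
  exists 0 => // Y v _ YN _ _ _ k; rewrite subn0 => kN.
  have -> : k = N by lia.
  by move=> i; rewrite YN subrr normr0 mul0r.
have [C C0 HC] := IH (ltnW dN).
pose k := (N - d.+1)%N; have kN : (0 < k < N)%N by rewrite /k; lia.
have k1N : (0 < k.+1 <= N)%N by lia.
have kN' : (0 < k <= N)%N by lia.
have crit j : \sum_(q < k.+1) \prod_(p < k) (y k j - y k.+1 (lift q p)) = 0.
  have := prod_sub_bary _ _ (y k.+1) (y k) (y k j) (y_inj _ k1N).
  rewrite (bigD1 j)//= subrr mul0r.
  under eq_bigr do rewrite ybary//.
  by rewrite -mulr_sumr => /esym/eqP; rewrite mulf_eq0 invr_eq0 pnatr_eq0 => /eqP.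
have [D D0 HD] := root_stability _ _ _ _ B B1 (gap k kN) crit (yB _ k1N) (yB _ kN').
pose E := 1 + C; have E0 : 0 <= E by rewrite addr_ge0.
exists (D * E + C); first by rewrite addr_ge0// mulr_ge0.
move=> Y v iY YN Y_inj v0 mv l lN i.
have YB : forall k, (0 < k <= N)%N -> forall i, `|Y k i| <= B.
  by apply: interlacing_bounded => // {}i; rewrite YN.
have [lk|lk] := ltnP k l.
  rewrite mulrDl ler_wpDl ?mulr_ge0//; apply: HC => //.
  by move: lk lN; rewrite /k; lia.
have lE : l = k by move: lk lN; rewrite /k; lia.
rewrite {l lN lk}lE in i *.
rewrite mulrDl ler_wpDr ?mulr_ge0// -mulrA.
apply: (HD (Y k.+1) (Y k)) => //.
- exact: iY.
- exact: Y_inj.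
- exact: YB.
- exact: YB.
- by rewrite mulr_ge0.
- move=> q; apply: (le_trans (mv k kN q)); rewrite /E mulrDl mul1r lerDl.
  by rewrite mulr_ge0.
- move=> q; apply: (@le_trans _ _ (C * v)); last first.
    by rewrite /E mulrDl mul1r lerDr.
  by apply: HC => //; rewrite /k; lia.
Qed.

(** The lattice is the unique maximum of the interaction and the maximum is
    quadratic on the whole interlacing region: the weights control the distance
    to the lattice by [rows_stability], and the loss in the AM-GM inequality
    controls the weights. Raised to the power (beta - 2) / 2 this is the Gaussian
    domination at scale 1 / sqrt beta. *)
Lemma Phi_gauss_bound (R : realType) N (y : array R) :
  (0 < N)%N ->
  critical N y ->
  exists2 c : R, 0 < c & forall Y : array R,
    interlacing N Y -> (forall i, Y N i = y N i) ->
    Phi N Y <= Phi N y *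
      expR (- (c * \sum_(1 <= k < N) \sum_(i < k) (Y k i - y k i) ^+ 2)).
Proof.
move=> N0 cy; have [_ y_inj _] := cy.
have [C C0 HC] := rows_stability _ _ _ cy.
pose K : R := \sum_(1 <= k < N) \sum_(i < k) 1.
have K0 : 0 <= K by do 2![apply: sumr_ge0 => ? _].
pose a : R := (2 * N.+1%:R)^-1.
have a0 : 0 < a by rewrite invr_gt0 mulr_gt0.
have E0 : 0 < C ^+ 2 * K + 1 by rewrite ltr_wpDl// mulr_ge0// sqr_ge0.
exists (a / (C ^+ 2 * K + 1)); first by rewrite divr_gt0.
move=> Y iY YN.
have Phi0 : 0 <= Phi N y.
  apply: prodr_ge0 => k _; rewrite mulr_ge0 ?invr_ge0 ?disc_ge0//.
  by apply: prodr_ge0 => p _; apply: prodr_ge0.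
(* Coinciding entries below the top row make the left-hand side vanish. *)
have [/existsP[k kD]|] := boolP [exists k : 'I_N, (0 < k)%N && (disc (Y k) == 0)].
  move: kD => /andP[k0 /eqP Dk].
  rewrite [leLHS](_ : _ = 0) ?mulr_ge0 ?expR_ge0//.
  apply/eqP; rewrite /Phi big_nat prodf_seq_eq0; apply/hasP; exists (k : nat).
    by rewrite mem_index_iota k0 ltn_ord.
  by rewrite k0 ltn_ord/= Dk invr0 mul0r.
rewrite negb_exists => /forallP Dnz.
have Ydisc k : (0 < k <= N)%N -> disc (Y k) != 0.
  move=> /andP[k0]; rewrite leq_eqVlt => /predU1P[kN|kN].
    rewrite kN; apply: inj_disc_neq0 => i j; rewrite !YN; apply: y_inj.
    by rewrite N0 leqnn.
  by have := Dnz (Ordinal kN); rewrite /= k0.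
pose x k q := k.+1%:R * bary (Y k.+1) (Y k) q - 1.
pose V := \sum_(1 <= k < N) \sum_(q < k.+1) x k q ^+ 2.
have V0 : 0 <= V by do 2![apply: sumr_ge0 => ? _]; exact: sqr_ge0.
(* The root of V bounds every single deviation, so it can play the role of v. *)
have xV k : (0 < k < N)%N -> forall q, `|x k q| <= Num.sqrt V.
  move=> kN q; rewrite -sqrtr_sqr ler_wsqrtr//.
  rewrite /V (bigD1_seq k)/= ?iota_uniq ?mem_index_iota//.
  rewrite (bigD1 q)//= -addrA lerDl addr_ge0//.
    by apply: sumr_ge0 => ? _; exact: sqr_ge0.
  by do 2![apply: sumr_ge0 => ? _]; exact: sqr_ge0.
have Y_inj k : (0 < k <= N)%N -> injective (Y k).
  by move=> kN; exact/disc_neq0_inj/Ydisc.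
have stab := HC Y (Num.sqrt V) (fun k => @interlacing_row _ _ _ k iY) YN Y_inj
  (sqrtr_ge0 _) xV.
apply: (le_trans (Phi_le _ _ _ _ N0 iY YN cy Ydisc)).
rewrite ler_wpM2l// ler_expR lerN2 -/a -/V.
rewrite -mulrA ler_pM2l// ler_pdivrMl//.
apply: (@le_trans _ _ (C ^+ 2 * V * K)); last first.
  by rewrite mulrDl mul1r mulrAC lerDl.
rewrite /K mulr_sumr big_nat [leRHS]big_nat; apply: ler_sum => k kN.
rewrite mulr_sumr; apply: ler_sum => i _; rewrite mulr1.
have kN' : (0 < k <= N)%N by lia.
rewrite -[V]sqr_sqrtr// -exprMn -real_normK ?num_real//.
by rewrite lerXn2r ?nnegrE ?mulr_ge0 ?sqrtr_ge0// stab.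
Qed.

(** * Expansion of the interaction around the lattice *)

(** The derivative of ln (1 + t) - t + t^2 / 2 is t^2 / (1 + t), which is at most
    2 t^2 for t >= - 1 / 2; conclude by the mean value theorem. *)
Lemma ln1Dx_taylor2 (R : realType) (x : R) : `|x| <= 2^-1 ->
  `|ln (1 + x) - x + x ^+ 2 / 2| <= 2 * `|x| ^+ 3.
Proof.
move=> xh; pose f (t : R) := ln (1 + t) - t + t ^+ 2 / 2.
have f0 : f 0 = 0 by rewrite /f addr0 ln1 subr0 expr0n mul0r addr0.
have df (t : R) : - 2^-1 <= t -> is_derive t 1 f (t ^+ 2 / (1 + t)).
  move=> t0; have t1 : 0 < 1 + t by lra.
  have d1 : is_derive t 1 (fun s : R => ln (1 + s)) ((1 + t)^-1).
    rewrite -[X in is_derive _ _ _ X]mulr1.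
    have dlin : is_derive t 1 (fun s : R => 1 + s) 1.
      by have := is_deriveD (is_derive_cst (1 : R) t 1) (is_derive_id t (1 : R)); rewrite add0r.
    exact: (@is_derive1_comp _ (@ln R) (fun s : R => 1 + s) _ _ _ (is_derive1_ln t1) dlin).
  apply: is_derive_eq.
  by rewrite /GRing.scale/=; field; rewrite gt_eqF.
have key (a b : R) : - 2^-1 <= a -> a <= b ->
    exists2 c, c \in `[a, b] & f b - f a = c ^+ 2 / (1 + c) * (b - a).
  move=> ha ab; apply: (@MVT_segment _ f (fun c => c ^+ 2 / (1 + c))) => // c.
    by rewrite in_itv/= => /andP[ac _]; apply: df; lra.
  apply: derivable_within_continuous => t; rewrite in_itv/= => /andP[at_ _].
  by apply: ex_derive; apply: df; lra.
have bnd c : `|c| <= `|x| -> `|c ^+ 2 / (1 + c)| <= 2 * `|x| ^+ 2.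
  move=> cx; have c1 : 2^-1 <= 1 + c.
    by move: (le_trans cx xh); rewrite ler_norml => /andP[? _]; lra.
  have c1' : 0 < 1 + c by lra.
  rewrite normrM normfV (gtr0_norm c1') ler_pdivrMr// normrX.
  apply: (@le_trans _ _ (`|x| ^+ 2)); first by rewrite lerXn2r ?nnegrE.
  have := sqr_ge0 `|x|; nra.
rewrite -/(f x) exprS mulrCA [leRHS]mulrC.
have [x0|x0] := leP 0 x.
  have [|//|c] := key 0 x; first by lra.
  rewrite in_itv/= f0 !subr0 => /andP[c0 cx] ->.
  by rewrite normrM ler_wpM2r// bnd// !ger0_norm.
have [||c] := key x 0; [|exact: ltW|].
  by move: xh; rewrite ler_norml => /andP[].
rewrite in_itv/= f0 !sub0r => /andP[cx c0] /(congr1 -%R); rewrite opprK => ->.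
by rewrite normrN normrM normrN ler_wpM2r// bnd// !ler0_norm ?lerN2// ltW.
Qed.

Lemma cvg_sqrt_pinfty (R : realType) : Num.sqrt b @[b --> +oo%R] --> (+oo : set_system R).
Proof.
apply/cvgryPge => A; near=> b; have : `|A| ^+ 2 <= b.
  by near: b; apply: nbhs_pinfty_ge; rewrite num_real.
move=> /ler_wsqrtr; rewrite sqrtr_sqr normr_id.
by apply: le_trans; exact: ler_norm.
Unshelve. all: by end_near. Qed.

Lemma cvg_invsqrt_pinfty (R : realType) :
  (Num.sqrt b)^-1 @[b --> +oo%R] --> (0 : R).
Proof.
apply/gtr0_cvgV0; last exact: cvg_sqrt_pinfty.
near=> b; rewrite sqrtr_gt0; near: b.
by apply: nbhs_pinfty_gt; rewrite num_real.
Unshelve. all: by end_near. Qed.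

Lemma cvg_ln_sqrt_second (R : realType) (v : R) :
  b * (ln (1 + v / Num.sqrt b) - v / Num.sqrt b) @[b --> +oo] --> - (v ^+ 2 / 2).
Proof.
apply/cvgrPdist_le => e e0; near=> b.
have b0 : 0 < b by near: b; apply: nbhs_pinfty_gt; rewrite num_real.
have s0 : 0 < Num.sqrt b by rewrite sqrtr_gt0.
set x := v / Num.sqrt b.
have xh : `|x| <= 2^-1.
  rewrite normrM normfV (gtr0_norm s0) ler_pdivrMr// mulrC -ler_pdivrMr// invrK.
  near: b; exact: (cvgryPge _).1 (cvg_sqrt_pinfty _) _.
have bE : b = Num.sqrt b ^+ 2 by rewrite sqr_sqrtr// ltW.
have bx : b * x ^+ 2 = v ^+ 2 by rewrite {1}bE -exprMn mulrC divfK// gt_eqF.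
have -> : - (v ^+ 2 / 2) - b * (ln (1 + x) - x) =
   - (b * (ln (1 + x) - x + x ^+ 2 / 2)).
  by rewrite -bx; ring.
rewrite normrN normrM (gtr0_norm b0).
apply: (@le_trans _ _ (b * (2 * `|x| ^+ 3))).
  by rewrite ler_pM2l// ln1Dx_taylor2.
have -> : b * (2 * `|x| ^+ 3) = 2 * `|v| ^+ 3 * (Num.sqrt b)^-1.
  rewrite normrM normfV (gtr0_norm s0) {1}bE; field; exact: lt0r_neq0.
rewrite ler_pdivrMr// -ler_pdivrMl//.
near: b; exact: (cvgryPge _).1 (cvg_sqrt_pinfty _) _.
Unshelve. all: by end_near. Qed.

(** The form in which the logarithm enters the exponent: the power of the
    interaction is (b - 2) / 2 and not b / 2, which makes no difference in the
    limit. *)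
Lemma cvg_ln_sqrt_half (R : realType) (v : R) :
  (b - 2) / 2 * (ln (1 + v / Num.sqrt b) - v / Num.sqrt b)
    @[b --> +oo] --> - (v ^+ 2 / 4).
Proof.
have invb : b^-1 @[b --> +oo%R] --> (0 : R).
  apply/gtr0_cvgV0; last exact: cvg_id.
  by near=> b; near: b; apply: nbhs_pinfty_gt; rewrite num_real.
rewrite [X in _ --> X](_ : _ = (2^-1 - 0) * - (v ^+ 2 / 2)); last by field.
apply: (@cvg_trans _ ((2^-1 - b^-1) *
    (b * (ln (1 + v / Num.sqrt b) - v / Num.sqrt b)) @[b --> +oo])).
  apply: near_eq_cvg; near=> b.
  have b0 : b != 0.
    by rewrite gt_eqF//; near: b; apply: nbhs_pinfty_gt; rewrite num_real.
  by rewrite mulrA; congr (_ * _); field.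
by apply: cvgM; [apply: cvgB => //; exact: cvg_cst|exact: cvg_ln_sqrt_second].
Unshelve. all: by end_near. Qed.

Lemma cvg_ln_sqrt_first (R : realType) (v : R) :
  Num.sqrt b * ln (1 + v / Num.sqrt b) @[b --> +oo] --> v.
Proof.
rewrite [X in _ --> X](_ : _ = 0 * - (v ^+ 2 / 2) + v); last by rewrite mul0r add0r.
apply: (@cvg_trans _ ((Num.sqrt b)^-1 *
    (b * (ln (1 + v / Num.sqrt b) - v / Num.sqrt b)) + v @[b --> +oo])).
  apply: near_eq_cvg; near=> b.
  have b0 : 0 < b by near: b; apply: nbhs_pinfty_gt; rewrite num_real.
  have s0 : Num.sqrt b != 0 by rewrite gt_eqF// sqrtr_gt0.
  have bE : b = Num.sqrt b ^+ 2 by rewrite sqr_sqrtr// ltW.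
  by rewrite {2}bE; field.
apply: cvgD; last exact: cvg_cst.
by apply: cvgM; [exact: cvg_invsqrt_pinfty|exact: cvg_ln_sqrt_second].
Unshelve. all: by end_near. Qed.

Lemma powR_prod (R : realType) (I : Type) (r : seq I) (P : pred I) (F : I -> R) s :
  (forall i, P i -> 0 <= F i) ->
  (\prod_(i <- r | P i) F i) `^ s = \prod_(i <- r | P i) F i `^ s.
Proof.
move=> F0.
suff [] : (\prod_(i <- r | P i) F i) `^ s = \prod_(i <- r | P i) F i `^ s /\
   0 <= \prod_(i <- r | P i) F i by [].
elim/big_rec2 : _ => [|i x y Pi [<- y0]]; first by rewrite powR1.
by rewrite powRM ?F0// mulr_ge0// F0.
Qed.

(** At x = 0 both sides are 0 because neither exponent vanishes. *)
Lemma powR_inv_sqr (R : realType) (x b : R) : 0 <= x -> 2 < b ->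
  x `^ (2 - b) = ((x ^+ 2)^-1) `^ ((b - 2) / 2).
Proof.
rewrite le_eqVlt => /predU1P[<- b2|x0 b2].
  rewrite expr0n invr0 !powR0//; first by rewrite mulf_neq0// gt_eqF// subr_gt0.
  by rewrite subr_eq0 lt_eqF.
rewrite -powR_mulrn ?ltW// -powR_inv1 ?powR_ge0// -!powRrM.
by congr (_ `^ _); field.
Qed.

(** The part of the exponent that depends on the perturbation. *)
Definition drift (R : realType) N (a : N.-tuple R) (Y : array R) : R :=
  \sum_(1 <= k < N) \sum_(i < k) Y k i * (a`_k.-1 - a`_k).
Arguments drift {R N} a Y.

(** Interlacing gives the sign of the differences inside a row, which is needed
    to write real powers of differences as powers of their squares. *)
Lemma corners_weightE (R : realType) N (a : N.-tuple R) b (Y : array R) :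
  2 < b -> interlacing N Y ->
  corners_weight a b Y = Phi N Y `^ ((b - 2) / 2) * expR (drift a Y).
Proof.
move=> b2 iY; rewrite /corners_weight iY mul1r; congr (_ * _).
have dist0 k (p : 'I_k) (q : 'I_k.+1) : 0 <= `|Y k p - Y k.+1 q| by [].
have D0 k : 0 <= (disc (Y k))^-1 by rewrite invr_ge0 disc_ge0.
have prod0 k : 0 <= \prod_(p < k) \prod_(q < k.+1) `|Y k p - Y k.+1 q|.
  by do 2![apply: prodr_ge0 => ? _].
rewrite /Phi powR_prod; last by move=> k _; rewrite mulr_ge0.
rewrite big_nat [RHS]big_nat; apply: eq_bigr => k kN.
rewrite powRM//; congr (_ * _).
  rewrite /disc -prodfV powR_prod; last first.
    by move=> i _; rewrite invr_ge0; apply: prodr_ge0 => j _; exact: sqr_ge0.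
  apply: eq_bigr => i _; rewrite -prodfV powR_prod; last first.
    by move=> j _; rewrite invr_ge0 sqr_ge0.
  apply: eq_bigr => j ij; rewrite powR_inv_sqr// subr_ge0.
  have ikY := interlacing_row _ _ _ _ iY kN.
  have /forallP uw := ikY.
  have /andP[_ h1] := uw j; have /andP[h2 _] := uw i.
  apply: (le_trans h1); apply: le_trans h2.
  by apply: (row_interlace_noninc _ _ _ _ ikY).
rewrite powR_prod; last by move=> p _; exact: prodr_ge0.
apply: eq_bigr => p _; rewrite powR_prod//; apply: eq_bigr => q _.
by congr (_ `^ _); field.
Qed.

(** Sums over the factors of the interaction, with their multiplicities 1 and -2,
    of a function of the relative displacement v = (change of the gap) / gap
    when the array y is moved in the direction tau. The logarithm of [Phi] and
    the exponent of the Gaussian free field are both of this form. *)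
Definition gap_sum (R : realType) N (y tau : array R) (psi : R -> R) : R :=
  \sum_(1 <= k < N)
    (\sum_(p < k) \sum_(q < k.+1)
        psi ((tau k p - tau k.+1 q) / (y k p - y k.+1 q)) -
     2 * \sum_(i < k) \sum_(j < k | (i < j)%N)
        psi ((tau k i - tau k j) / (y k i - y k j))).
Arguments gap_sum {R} N y tau psi.

Lemma gap_sumDZ (R : realType) N (y tau : array R) (f g : R -> R) c :
  gap_sum N y tau (fun v => f v + c * g v) =
  gap_sum N y tau f + c * gap_sum N y tau g.
Proof.
rewrite /gap_sum mulr_sumr -big_split; apply: eq_bigr => k _ /=.
have big2 m n (P : 'I_m -> pred 'I_n) (u : 'I_m -> 'I_n -> R) :
    \sum_(i < m) \sum_(j < n | P i j) (f (u i j) + c * g (u i j)) =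
    \sum_(i < m) \sum_(j < n | P i j) f (u i j) +
    c * \sum_(i < m) \sum_(j < n | P i j) g (u i j).
  rewrite mulr_sumr -big_split; apply: eq_bigr => i _ /=.
  by rewrite mulr_sumr -big_split.
rewrite (big2 k k.+1 (fun _ _ => true)) (big2 k k (fun i j => (i < j)%N)).
by ring.
Qed.

Lemma cvg_bigsum (R : realType) (I T : Type) (r : seq I) (P : pred I)
    (f : I -> T -> R) (l : I -> R) (F : set_system T) {FF : Filter F} :
  (forall i, f i b @[b --> F] --> l i) ->
  \sum_(i <- r | P i) f i b @[b --> F] --> \sum_(i <- r | P i) l i.
Proof.
move=> fl; apply: cvg_big => [|i _]; last exact: fl.
exact: (@add_continuous R^o).
Qed.

Lemma cvg_gap_sum (R : realType) N (y tau : array R) (psi : R -> R -> R) f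
    (F : set_system R) {FF : Filter F} :
  (forall v, psi b v @[b --> F] --> f v) ->
  gap_sum N y tau (psi b) @[b --> F] --> gap_sum N y tau f.
Proof.
move=> psif; apply: cvg_bigsum => k; apply: cvgB.
  by apply: cvg_bigsum => p; apply: cvg_bigsum => q; exact: psif.
apply: cvgM; first exact: cvg_cst.
by apply: cvg_bigsum => p; apply: cvg_bigsum => q; exact: psif.
Qed.

(** The Gaussian free field is the second-order part of [Phi_perturb] for
    s = sqrt beta, multiplied by beta / 2. *)
Lemma dgff_weightE (R : realType) N (y zeta : array R) :
  dgff_weight N y zeta = expR (gap_sum N y zeta (fun v => - (v ^+ 2 / 4))).
Proof.
have sqE c (u v : R) : u ^+ 2 / (c * v ^+ 2) = (u / v) ^+ 2 / c.
  by rewrite exprMn exprVn invfM mulrA mulrAC.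
rewrite /dgff_weight /gap_sum; congr expR; apply: eq_bigr => k _; rewrite addrC; congr (_ + _).
  rewrite -sumrN; apply: eq_bigr => p _; rewrite -sumrN; apply: eq_bigr => q _.
  by rewrite sqE.
rewrite -mulrN -sumrN mulr_sumr; apply: eq_bigr => i _.
rewrite -sumrN mulr_sumr; apply: eq_bigr => j _.
by rewrite sqE opprK; move: (_ ^+ 2) => e; field.
Qed.

(** Moving y by tau / s multiplies a gap g by 1 + v / s, with v the relative
    displacement; signs of gaps do not change as long as this is positive. *)
Lemma Phi_perturb (R : realType) N (y tau Y : array R) s :
  (forall k (i : 'I_k), (k <= N)%N -> Y k i = y k i + tau k i / s) ->
  (forall k, (0 < k < N)%N -> forall p q, y k p != y k.+1 q) ->
  (forall k, (0 < k < N)%N -> injective (y k)) ->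
  (forall k, (0 < k < N)%N -> forall p q,
    0 < 1 + (tau k p - tau k.+1 q) / (y k p - y k.+1 q) / s) ->
  (forall k, (0 < k < N)%N -> forall i j,
    0 < 1 + (tau k i - tau k j) / (y k i - y k j) / s) ->
  Phi N Y = Phi N y * expR (gap_sum N y tau (fun v => ln (1 + v / s))).
Proof.
move=> YE ne1 ne2 pos1 pos2.
rewrite /Phi /gap_sum expR_sum -big_split/= big_nat [RHS]big_nat.
apply: eq_bigr => k kN; rewrite expRD [in RHS](mulrC (expR _)) mulrACA; congr (_ * _).
  rewrite /disc -!prodfV -mulrN -sumrN mulr_sumr.
  rewrite expR_sum -big_split; apply: eq_bigr => i _ /=.
  rewrite -sumrN mulr_sumr expR_sum -!prodfV -big_split; apply: eq_bigr => j ij /=.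
  have yij : y k i - y k j != 0.
    by rewrite subr_eq0 (inj_eq (ne2 k kN)) -val_eqE neq_ltn ij.
  rewrite !YE; [|by lia..].
  set v := (tau k i - tau k j) / (y k i - y k j).
  have v0 : 0 < 1 + v / s by exact: pos2.
  have -> : y k i + tau k i / s - (y k j + tau k j / s) = (y k i - y k j) * (1 + v / s).
    by rewrite /v mulrDr mulr1 mulrA mulrCA divff// mulr1; ring.
  rewrite mulrN expRN.
  have -> : 2 * ln (1 + v / s) = ln ((1 + v / s) ^+ 2).
    by rewrite lnXn// mulr_natl.
  by rewrite lnK ?posrE ?exprn_gt0// exprMn invfM mulrC.
rewrite expR_sum -big_split; apply: eq_bigr => p _ /=.
rewrite expR_sum -big_split; apply: eq_bigr => q _ /=.
rewrite !YE; [|by lia..].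
have ypq : y k p - y k.+1 q != 0 by rewrite subr_eq0 ne1.
set v := (tau k p - tau k.+1 q) / (y k p - y k.+1 q).
have v0 : 0 < 1 + v / s by exact: pos1.
have -> : y k p + tau k p / s - (y k.+1 q + tau k.+1 q / s) =
    (y k p - y k.+1 q) * (1 + v / s).
  by rewrite /v mulrDr mulr1 mulrA mulrCA divff// mulr1; ring.
by rewrite normrM (gtr0_norm v0) lnK// posrE.
Qed.

Lemma critical_rows_neq (R : realType) N (y : array R) : critical N y ->
  forall k, (0 < k < N)%N -> forall p q, y k p != y k.+1 q.
Proof.
move=> cy k kN p q; have [gap _ _] := cy; have /andP[lo hi] := gap k kN p.
have y_noninc := row_interlace_noninc _ _ (y k) (y k.+1)
  (interlacing_row _ _ _ _ (critical_interlacing _ _ _ cy) kN).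
have [pq|qp] := ltnP p q.
  rewrite gt_eqF//; apply: le_lt_trans lo; apply: y_noninc.
  by rewrite /= /bump.
by rewrite lt_eqF//; apply: (lt_le_trans hi); apply: y_noninc.
Qed.

Lemma Phi_critical_gt0 (R : realType) N (y : array R) :
  critical N y -> 0 < Phi N y.
Proof.
move=> cy; have ne := critical_rows_neq _ _ _ cy; have [_ y_inj _] := cy.
rewrite /Phi big_nat; apply: prodr_gt0 => k kN; rewrite mulr_gt0//.
  rewrite invr_gt0 lt_neqAle disc_ge0 andbT eq_sym; apply: inj_disc_neq0.
  by apply: y_inj; lia.
apply: prodr_gt0 => p _; apply: prodr_gt0 => q _.
by rewrite normr_gt0 subr_eq0 ne.
Qed.

Lemma cvg_perturb (R : realType) (u t : R) :
  u + t / Num.sqrt b @[b --> +oo] --> u.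
Proof.
rewrite [X in _ --> X](_ : _ = u + t * 0); last by rewrite mulr0 addr0.
apply: cvgD; first exact: cvg_cst.
by apply: cvgM; [exact: cvg_cst|exact: cvg_invsqrt_pinfty].
Qed.

Lemma near_perturb_interlacing (R : realType) N (y tau : array R) (Y : R -> array R) :
  critical N y ->
  (forall b k (i : 'I_k), (k <= N)%N -> Y b k i = y k i + tau k i / Num.sqrt b) ->
  \forall b \near +oo, interlacing N (Y b).
Proof.
move=> [gap _ _] YE.
have sep (u u' t t' : R) : u < u' ->
    \forall b \near +oo, u + t / Num.sqrt b <= u' + t' / Num.sqrt b.
  move=> uu'; near=> b.
  have : u + t / Num.sqrt b < (u + u') / 2.
    by near: b; apply: cvgr_lt (cvg_perturb _ _ _) _ _; lra.
  have : (u + u') / 2 < u' + t' / Num.sqrt b.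
    by near: b; apply: cvgr_gt (cvg_perturb _ _ _) _ _; lra.
  by move=> h1 h2; exact: ltW (lt_trans h2 h1).
have : \forall b \near +oo, forall (k : 'I_N) (i : 'I_k), (0 < k)%N ->
    Y b k.+1 (lift ord0 i) <= Y b k i <= Y b k.+1 (widen_ord (leqnSn k) i).
  apply: filter_forall => k; apply: filter_forall => i.
  have [k0|k0] := posnP k; first by apply: nearW => b /= kpos; exfalso; lia.
  have kN : (0 < k < N)%N by rewrite k0 ltn_ord.
  have /andP[lo hi] := gap k kN i.
  apply: filterS2 (sep _ _ (tau k.+1 (lift ord0 i)) (tau k i) lo)
    (sep _ _ (tau k i) (tau k.+1 (widen_ord (leqnSn k) i)) hi) => b lo' hi' _.
  by rewrite !YE ?lo' ?hi'//; lia.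
apply: filterS => b H; apply/forallP => k; apply/implyP => k0.
by apply/forallP => i; exact: H.
Unshelve. all: by end_near. Qed.

Lemma near_perturb_Phi (R : realType) N (y tau : array R) (Y : R -> array R) :
  critical N y ->
  (forall b k (i : 'I_k), (k <= N)%N -> Y b k i = y k i + tau k i / Num.sqrt b) ->
  \forall b \near +oo, Phi N (Y b) =
    Phi N y * expR (gap_sum N y tau (fun v => ln (1 + v / Num.sqrt b))).
Proof.
move=> cy YE; have [_ y_inj _] := cy.
have pos (v : R) : \forall b \near +oo, 0 < 1 + v / Num.sqrt b.
  by apply: cvgr_gt (cvg_perturb _ _ _) _ _; exact: ltr01.
near=> b; apply: Phi_perturb.
- by move=> k i; exact: YE.
- exact: critical_rows_neq.
- by move=> k kN; apply: y_inj; lia.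
- move=> k /andP[k0 kN] p q; rewrite -[k]/(nat_of_ord (Ordinal kN)) in p q *.
  move: (Ordinal kN) p q; near: b.
  apply: filter_forall => i; apply: filter_forall => p; apply: filter_forall => q.
  exact: pos.
- move=> k /andP[k0 kN] p q; rewrite -[k]/(nat_of_ord (Ordinal kN)) in p q *.
  move: (Ordinal kN) p q; near: b.
  apply: filter_forall => i; apply: filter_forall => p; apply: filter_forall => q.
  exact: pos.
Unshelve. all: by end_near. Qed.

Lemma gap_sumZ (R : realType) N (y tau : array R) (g : R -> R) c :
  gap_sum N y tau (fun v => c * g v) = c * gap_sum N y tau g.
Proof.
have g0 : gap_sum N y tau (fun=> 0) = 0.
  rewrite /gap_sum big1// => k _.
  by rewrite !big1 ?mulr0 ?subrr// => i _; rewrite big1.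
have := gap_sumDZ _ N y tau (fun=> 0) g c; rewrite g0 add0r => <-.
by congr gap_sum; apply/funext => v; rewrite add0r.
Qed.

(** The first-order part of the interaction vanishes at the lattice, because the
    lattice is a maximum and tau can be replaced by its opposite. *)
Lemma gap_sum_critical (R : realType) N (y tau : array R) :
  (0 < N)%N -> critical N y -> (forall i, tau N i = 0) ->
  gap_sum N y tau id = 0.
Proof.
move=> N0 cy tau0.
have le0 (t : array R) : (forall i, t N i = 0) -> gap_sum N y t id <= 0.
  move=> t0; rewrite leNgt; apply/negP => gap_gt0.
  pose Y b : array R := fun k i => y k i + t k i / Num.sqrt b.
  have YE b k (i : 'I_k) : (k <= N)%N -> Y b k i = y k i + t k i / Num.sqrt b by [].
  have lim : Num.sqrt b * gap_sum N y t (fun v => ln (1 + v / Num.sqrt b))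
      @[b --> +oo] --> gap_sum N y t id.
    under eq_fun do rewrite -gap_sumZ.
    by apply: cvg_gap_sum => v; exact: cvg_ln_sqrt_first.
  have [c c0 HPhi] := Phi_gauss_bound _ _ _ N0 cy.
  have [b [[iYb PhiYb] lt0]] : exists b, (interlacing N (Y b) /\
      Phi N (Y b) =
        Phi N y * expR (gap_sum N y t (fun v => ln (1 + v / Num.sqrt b)))) /\
      0 < Num.sqrt b * gap_sum N y t (fun v => ln (1 + v / Num.sqrt b)).
    apply: (@filter_ex _ (pinfty_nbhs R)); apply: filterI; first apply: filterI.
    - exact: near_perturb_interlacing cy YE.
    - exact: near_perturb_Phi cy YE.
    - exact: (cvgr_gt _ lim).
  have YbN i : Y b N i = y N i by rewrite /Y t0 mul0r addr0.
  have := HPhi _ iYb YbN; rewrite PhiYb ler_pM2l ?Phi_critical_gt0// ler_expR.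
  apply/negP; rewrite -ltNge; apply: (@le_lt_trans _ _ 0).
    rewrite oppr_le0 mulr_ge0//; first exact: ltW.
    by do 2![apply: sumr_ge0 => ? _]; exact: sqr_ge0.
  by move: lt0; apply: contraTT; rewrite -!leNgt; exact: mulr_ge0_le0 (sqrtr_ge0 _).
apply/eqP; rewrite eq_le le0//= -oppr_le0 -mulN1r -gap_sumZ.
suff -> : gap_sum N y tau (fun v => -1 * v) = gap_sum N y (fun k i => - tau k i) id.
  by apply: le0 => i; rewrite tau0 oppr0.
apply: eq_bigr => k _; congr (_ - 2 * _).
  by apply: eq_bigr => p _; apply: eq_bigr => q _; ring.
by apply: eq_bigr => p _; apply: eq_bigr => q _; ring.
Qed.

Lemma powR_expR (R : realType) (x s : R) : expR x `^ s = expR (s * x).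
Proof. by rewrite -expRM mulrC. Qed.

Lemma corners_weight_critical_gt0 (R : realType) N (a : N.-tuple R) b (y : array R) :
  2 < b -> critical N y -> 0 < corners_weight a b y.
Proof.
move=> b2 cy; rewrite corners_weightE//; last exact: critical_interlacing.
by rewrite mulr_gt0 ?expR_gt0// powR_gt0// Phi_critical_gt0.
Qed.

Lemma drift_perturb (R : realType) N (a : N.-tuple R) (y tau Y : array R) h :
  (forall k (i : 'I_k), (k <= N)%N -> Y k i = y k i + tau k i / h) ->
  drift a Y = drift a y + drift a tau / h.
Proof.
move=> YE; rewrite /drift mulr_suml -big_split [LHS]big_nat [RHS]big_nat.
apply: eq_bigr => k kN; rewrite mulr_suml -big_split; apply: eq_bigr => i _ /=.
by rewrite YE; [ring|lia].
Qed.

(** First-order terms may be subtracted from the logarithms by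
    [gap_sum_critical]; what is left converges term by term. The drift is
    multiplied by 1 / sqrt b and disappears, so that the limit does not depend
    on the perturbation. *)
Lemma cvg_corners_ratio (R : realType) N (a : N.-tuple R) (y tau : array R)
    (Y : R -> array R) :
  (0 < N)%N -> critical N y -> (forall i, tau N i = 0) ->
  (forall b k (i : 'I_k), (k <= N)%N -> Y b k i = y k i + tau k i / Num.sqrt b) ->
  corners_weight a b (Y b) / corners_weight a b y @[b --> +oo]
    --> dgff_weight N y tau.
Proof.
move=> N0 cy tau0 YE; rewrite dgff_weightE.
pose ex b := gap_sum N y tau
    (fun v => (b - 2) / 2 * (ln (1 + v / Num.sqrt b) - v / Num.sqrt b)) +
  drift a tau * (Num.sqrt b)^-1.
apply: (@cvg_trans _ (expR (ex b) @[b --> +oo])); last first.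
  rewrite -[gap_sum _ _ _ _]addr0 -[X in _ + X](mulr0 (drift a tau)).
  apply: (@cvg_comp _ _ _ ex expR); last exact: continuous_expR.
  apply: cvgD; first by apply: cvg_gap_sum => v; exact: cvg_ln_sqrt_half.
  by apply: cvgM; [exact: cvg_cst|exact: cvg_invsqrt_pinfty].
apply: near_eq_cvg; near=> b.
have b2 : 2 < b by near: b; apply: nbhs_pinfty_gt; rewrite num_real.
have iY : interlacing N (Y b) by near: b; exact: near_perturb_interlacing cy YE.
have PhiY : Phi N (Y b) =
    Phi N y * expR (gap_sum N y tau (fun v => ln (1 + v / Num.sqrt b))).
  by near: b; exact: near_perturb_Phi cy YE.
have Phi0 := Phi_critical_gt0 _ _ _ cy.
rewrite !corners_weightE//; last exact: critical_interlacing.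
rewrite PhiY (drift_perturb _ _ _ _ _ _ _ (YE b)) powRM ?expR_ge0 ?ltW// powR_expR expRD.
set G := gap_sum N y tau (fun v => ln (1 + v / Num.sqrt b)).
have -> : ex b = (b - 2) / 2 * G + drift a tau / Num.sqrt b.
  rewrite /ex; congr (_ + _).
  have -> : (fun v => (b - 2) / 2 * (ln (1 + v / Num.sqrt b) - v / Num.sqrt b)) =
      (fun v => (b - 2) / 2 * ln (1 + v / Num.sqrt b) +
                - ((b - 2) / 2 / Num.sqrt b) * id v).
    by apply/funext => v /=; ring.
  by rewrite gap_sumDZ gap_sum_critical// mulr0 addr0 gap_sumZ.
rewrite expRD.
have P0 : Phi N y `^ ((b - 2) / 2) != 0 by rewrite gt_eqF// powR_gt0.
have e0 : expR (drift a y) != 0 by rewrite gt_eqF// expR_gt0.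
by field; rewrite e0 P0.
Unshelve. all: by end_near. Qed.

(** The drift is bounded on the interlacing region since all entries lie in the
    range of the top row. The threshold 4 makes (b - 2) / 2 at least b / 4. *)
Lemma corners_ratio_le (R : realType) N (a : N.-tuple R) (y : array R) :
  (0 < N)%N -> critical N y ->
  exists2 c : R, 0 < c & exists K : R, forall b (Y : array R), 4 <= b ->
    (forall i, Y N i = y N i) ->
    corners_weight a b Y / corners_weight a b y <=
    K * expR (- (c * (b * \sum_(1 <= k < N) \sum_(i < k) (Y k i - y k i) ^+ 2))).
Proof.
move=> N0 cy; have [c c0 HPhi] := Phi_gauss_bound _ _ _ N0 cy.
pose B := 1 + \sum_i `|y N i|.
have yNB i : `|y N i| <= B.
  by rewrite /B (bigD1 i)//= addrCA lerDl addr_ge0// sumr_ge0.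
pose D := \sum_(1 <= k < N) \sum_(i < k) (2 * B) * `|a`_k.-1 - a`_k|.
exists (c / 4); first by rewrite divr_gt0.
exists (expR D) => b Y b4 YN.
have b2 : 2 < b by lra.
have W0 := corners_weight_critical_gt0 _ _ a _ _ b2 cy.
have [iY|niY] := boolP (interlacing N Y); last first.
  rewrite {1}/corners_weight (negbTE niY) !mul0r.
  by rewrite mulr_ge0// expR_ge0.
have bnd (X : array R) : interlacing N X -> (forall i, X N i = y N i) ->
    forall k, (0 < k <= N)%N -> forall i, `|X k i| <= B.
  move=> iX XN; apply: interlacing_bounded; first by move=> k; exact: interlacing_row.
  by move=> i; rewrite XN.
have iy := critical_interlacing _ _ _ cy.
have driftD : drift a Y - drift a y <= D.
  rewrite /drift /D -sumrB big_nat [leRHS]big_nat; apply: ler_sum => k kN.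
  rewrite -sumrB; apply: ler_sum => i _; rewrite -mulrBl.
  apply: (le_trans (ler_norm _)); rewrite normrM ler_wpM2r//.
  have kN' : (0 < k <= N)%N by lia.
  apply: (le_trans (ler_normB _ _)).
  have := bnd _ iY YN k kN' i; have := bnd _ iy (fun=> erefl) k kN' i.
  lra.
rewrite ler_pdivrMr// !corners_weightE//.
set S := \sum_(1 <= k < N) _.
have S0 : 0 <= S by do 2![apply: sumr_ge0 => ? _]; exact: sqr_ge0.
have Phi0 := Phi_critical_gt0 _ _ _ cy.
have PhiY0 : 0 <= Phi N Y.
  apply: prodr_ge0 => k _; rewrite mulr_ge0 ?invr_ge0 ?disc_ge0//.
  by apply: prodr_ge0 => p _; apply: prodr_ge0.
have s0 : 0 <= (b - 2) / 2 by lra.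
have HP : Phi N Y `^ ((b - 2) / 2) <=
    Phi N y `^ ((b - 2) / 2) * expR ((b - 2) / 2 * - (c * S)).
  rewrite -powR_expR -powRM ?expR_ge0//; last exact: ltW.
  have PE0 : 0 <= Phi N y * expR (- (c * S)) by rewrite mulr_ge0 ?expR_ge0 ?ltW.
  exact: (@ge0_ler_powR R _ s0 (Phi N Y) (Phi N y * expR (- (c * S)))
    PhiY0 PE0 (HPhi Y iY YN)).
apply: (@le_trans _ _ (Phi N y `^ ((b - 2) / 2) * expR (- (c / 4 * (b * S))) *
    (expR D * expR (drift a y)))); last first.
  by rewrite le_eqVlt; apply/orP; left; apply/eqP; ring.
apply: ler_pM; rewrite ?powR_ge0 ?expR_ge0//; last first.
  by rewrite -expRD ler_expR -lerBlDr.
apply: (le_trans HP); rewrite ler_wpM2l ?powR_ge0// ler_expR.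
rewrite mulrN lerN2.
have -> : (b - 2) / 2 * (c * S) = (b - 2) / 2 * c * S by ring.
have -> : c / 4 * (b * S) = b / 4 * c * S by ring.
by rewrite ler_wpM2r// ler_wpM2r//; [exact: ltW|lra].
Qed.

(** * Lebesgue integration over tuples *)
Lemma integral_lebesgue_tupleS (R : realType) n
    (F : n.+1.-tuple R -> \bar R) :
  measurable_fun [set: n.+1.-tuple R] F -> (forall t, (0 <= F t)%E) ->
  (\int[lebesgue_tuple n.+1]_t F t =
   \int[lebesgue_measure]_x \int[lebesgue_tuple n]_t F [tuple of x :: t])%E.
Proof.
move=> mF F0.
pose c (x : measurableTypeR R * n.-tuple (measurableTypeR R)) :=
  [the n.+1.-tuple (measurableTypeR R) of x.1 :: x.2].
have mc : measurable_fun [set: measurableTypeR R * n.-tuple (measurableTypeR R)] c.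
  by apply: measurable_cons; [exact: measurable_fst|exact: measurable_snd].
transitivity (\int[pushforward (lebesgue_measure \x lebesgue_tuple n) c]_t F t)%E.
  exact: eq_measure_integral.
rewrite ge0_integral_pushforward// preimage_setT fubini_tonelli1//.
  exact: measurableT_comp mF mc.
by move=> x; exact: F0.
Qed.

(** The image of the Lebesgue measure by the affine map agrees with s times the
    Lebesgue measure on bounded intervals, hence everywhere. *)
Lemma ge0_integral_affine (R : realType) (F : R -> \bar R) (y s : R) : 0 < s ->
  measurable_fun [set: R] F -> (forall x, (0 <= F x)%E) ->
  (\int[lebesgue_measure]_x F (y + x / s)%R =
   s%:E * \int[lebesgue_measure]_x F x)%E.
Proof.
move=> s0 mF F0; have sn0 : s != 0 by rewrite gt_eqF.
pose phi (x : measurableTypeR R) : measurableTypeR R := y + x / s.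
have mphi : measurable_fun [set: measurableTypeR R] phi.
  by apply: measurable_funD => //; apply: measurable_funM.
have si0 : 0 <= s^-1 by rewrite invr_ge0 ltW.
(* The measure structure of a pushforward depends on the measurability of the
   map, which unification cannot find. *)
pose m : {measure set (measurableTypeR R) -> \bar R} :=
  mscale (NngNum si0)
   (measure_function_pushforward__canonical__measure_function_Measure
     (@lebesgue_measure R) mphi).
have mE (A : set (measurableTypeR R)) :
    measurable A -> lebesgue_measure A = m A.
  apply: lebesgue_measure_unique => _ [[a b]] _ <-.
  transitivity (s^-1%:E * lebesgue_measure (phi @^-1` `]a, b]%classic))%E => //.
  have -> : phi @^-1` `]a, b]%classic = `](a - y) * s, (b - y) * s]%classic.
    apply/seteqP; split => x /=; rewrite !in_itv/= /phi;
      by rewrite -ltrBlDl -lerBrDl ltr_pdivlMr// ler_pdivrMr.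
  rewrite !lebesgue_measure_itv/= !lte_fin ltr_pM2r// ltrD2r.
  case: ifPn => _; last by rewrite mule0.
  by rewrite -!EFinD -EFinM; congr EFin; field.
rewrite -[LHS](@ge0_integral_pushforward _ _ _ _ _ phi mphi _ setT F)//.
rewrite [X in (_ * X)%E](eq_measure_integral m); last by move=> A mA _; exact: mE.
rewrite ge0_integral_mscale//= muleA -EFinM divff// mul1e.
exact: eq_measure_integral.
Qed.

Definition zoom (R : realType) n (y : n.-tuple R) (s : R) (t : n.-tuple R) :
    n.-tuple R :=
  [tuple tnth y i + tnth t i / s | i < n].
Arguments zoom {R n} y s t.

Lemma measurable_zoom (R : realType) n (y : n.-tuple R) s :
  measurable_fun [set: n.-tuple R] (zoom y s).
Proof.
apply/measurable_fun_tnthP => i.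
rewrite (_ : _ \o _ = fun t => tnth y i + tnth t i / s); last first.
  by apply/funext => t /=; rewrite tnth_mktuple.
by apply: measurable_funD => //; apply: measurable_funM => //; exact: measurable_tnth.
Qed.

Lemma measurable_cons_tuple (R : realType) n (x : R) :
  measurable_fun [set: n.-tuple R] (fun t => [tuple of x :: t] : n.+1.-tuple R).
Proof. by apply: measurable_cons. Qed.

Lemma measurable_partial_integral (R : realType) n (F : n.+1.-tuple R -> \bar R) :
  measurable_fun [set: n.+1.-tuple R] F -> (forall t, (0 <= F t)%E) ->
  measurable_fun [set: R]
    (fun x : R => \int[lebesgue_tuple n]_t F [tuple of x :: t])%E.
Proof.
move=> mF F0.
pose c (x : measurableTypeR R * n.-tuple (measurableTypeR R)) :=
  [the n.+1.-tuple (measurableTypeR R) of x.1 :: x.2].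
have mc : measurable_fun [set: measurableTypeR R * n.-tuple (measurableTypeR R)] c.
  by apply: measurable_cons; [exact: measurable_fst|exact: measurable_snd].
apply: (@measurable_fun_fubini_tonelli_F _ _ _ _ _ (lebesgue_tuple n) (F \o c)).
  exact: measurableT_comp mF mc.
by move=> x; exact: F0.
Qed.

Lemma ge0_integral_zoom (R : realType) n (F : n.-tuple R -> \bar R) y (s : R) :
  0 < s -> measurable_fun [set: n.-tuple R] F -> (forall t, (0 <= F t)%E) ->
  (\int[lebesgue_tuple n]_t F (zoom y s t) =
   (s ^+ n)%:E * \int[lebesgue_tuple n]_t F t)%E.
Proof.
move=> s0; elim: n => [|n IH] in F y *; move=> mF F0.
  rewrite expr0 mul1e; apply: eq_integral => t _.
  by rewrite tuple0 [in RHS]tuple0.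
rewrite !integral_lebesgue_tupleS//; last first.
  by apply: measurableT_comp => //; exact: measurable_zoom.
pose a := thead y; pose y' := [tuple of behead y].
pose G (x : R) := (\int[lebesgue_tuple n]_t F [tuple of x :: t])%E.
have G0 x : (0 <= G x)%E by exact: integral_ge0.
have mG : measurable_fun [set: R] G by exact: measurable_partial_integral.
transitivity (\int[lebesgue_measure]_x ((s ^+ n)%:E * G (a + x / s)%R))%E.
    apply: eq_integral => x _; rewrite -(IH _ y')//.
    apply: eq_integral => t _; congr F; apply: eq_from_tnth => i.
    rewrite tnth_mktuple; case: (unliftP ord0 i) => [j|] ->.
      by rewrite !tnthS tnth_mktuple (tuple_eta y) tnthS.
    by rewrite !tnth0 {1}(tuple_eta y) tnth0.
  by apply: measurableT_comp => //; exact: measurable_cons_tuple.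
rewrite ge0_integralZl//; last by rewrite lee_fin exprn_ge0// ltW.
  by rewrite ge0_integral_affine// muleA -EFinM exprSr.
apply: measurableT_comp => //; apply: measurable_funD => //.
exact: measurable_funM.
Qed.

Lemma integral_prod_tuple (R : realType) n (g : R -> R) :
  measurable_fun [set: R] g -> (forall x, 0 <= g x) ->
  (\int[lebesgue_tuple n]_t (\prod_(i < n) g (tnth t i))%:E =
   (\int[lebesgue_measure]_x (g x)%:E) ^+ n)%E.
Proof.
move=> mg g0; elim: n => [|n IH].
  rewrite expe0; under eq_integral do rewrite big_ord0.
  by rewrite integral_cst// mul1e; exact: diracT.
have p0 m (t : m.-tuple R) : 0 <= \prod_(i < m) g (tnth t i).
  by apply: prodr_ge0.
have mp m : measurable_fun [set: m.-tuple R]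
    (fun t => (\prod_(i < m) g (tnth t i))%:E).
  apply/measurable_EFinP; apply: measurable_prod => i _.
  by apply: measurableT_comp => //; exact: measurable_tnth.
rewrite integral_lebesgue_tupleS//; last by move=> t; rewrite lee_fin.
transitivity (\int[lebesgue_measure]_x ((g x)%:E *
    (\int[lebesgue_measure]_x (g x)%:E) ^+ n))%E.
  apply: eq_integral => x _; rewrite -IH -ge0_integralZl//; first last.
  - by rewrite lee_fin.
  - by move=> t _; rewrite lee_fin.
  - exact: mp.
  apply: eq_integral => t _; rewrite -EFinM; congr EFin.
  rewrite big_ord_recl tnth0; congr (_ * _); apply: eq_bigr => i _.
  by rewrite tnthS.
rewrite ge0_integralZr//; first by rewrite expeS.
- exact/measurable_EFinP.
- by move=> x _; rewrite lee_fin.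
- by apply: expe_ge0; apply: integral_ge0 => x _; rewrite lee_fin.
Qed.

(** The density is almost everywhere the Radon-Nikodym derivative of the law of
    X, for which the formula is known. *)
Lemma ge0_integral_density d d' (T : measurableType d) (S : measurableType d')
    (R : realType) (P : probability T R)
    (mu : {sigma_finite_measure set S -> \bar R}) (X : T -> S) (f : S -> R) :
  measurable_fun [set: T] X -> measurable_fun [set: S] f ->
  (forall s, 0 <= f s) ->
  (forall A, measurable A -> P [set w | A (X w)] =
     \int[mu]_(s in A) (f s)%:E)%E ->
  forall g : S -> \bar R, measurable_fun [set: S] g -> (forall s, (0 <= g s)%E) ->
  (\int[P]_w g (X w) = \int[mu]_s (g s * (f s)%:E))%E.
Proof.
move=> mX mf f0 Pf g mg g0.
pose mX' := isMeasurableFun.Build _ _ _ _ _ mX.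
pose X' : {mfun _ >-> _} := HB.pack X mX'.
pose nu : {finite_measure set S -> \bar R} := distribution P X'.
have nuE A : measurable A -> nu A = (\int[mu]_(s in A) (f s)%:E)%E by exact: Pf.
have dom : nu `<< mu.
  apply/null_content_dominatesP => A mA muA0; rewrite nuE//.
  by apply: null_set_integral => //; exact/measurable_EFinP/measurable_funTS.
transitivity (\int[nu]_s g s)%E.
  by rewrite ge0_integral_distribution.
rewrite -(Radon_Nikodym_SigmaFinite.change_of_variables dom g0)//.
have fi : mu.-integrable setT (EFin \o f).
  apply/integrableP; split; first exact/measurable_EFinP.
  under eq_integral do rewrite /= ger0_norm//.
  by rewrite -nuE// ltey_eq fin_num_measure.
have RNi := Radon_Nikodym_SigmaFinite.f_integrable dom.
apply: ge0_ae_eq_integral => //.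
- by apply: emeasurable_funM => //; exact: measurable_int RNi.
- by apply: emeasurable_funM => //; exact/measurable_EFinP.
- by move=> s _; rewrite mule_ge0// Radon_Nikodym_SigmaFinite.f_ge0.
- by move=> s _; rewrite mule_ge0// lee_fin.
apply: ae_eqe_mul2l; apply: integral_ae_eq => //; first exact/measurable_EFinP.
by move=> E _ mE; rewrite -Radon_Nikodym_SigmaFinite.f_integral// nuE.
Qed.

(** Borel measurability for the product topology, tested on coordinates: rounding
    each coordinate down to a multiple of 1 / (m + 1) gives measurable maps with
    countably many values that converge pointwise to X, and f is continuous. *)
Lemma measurable_continuous_ptws d (T : measurableType d) (R : realType)
    (I : finType) (X : T -> I -> R) (f : {ptws I -> R} -> R) :
  (forall i, measurable_fun [set: T] (fun w => X w i)) -> continuous f ->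
  measurable_fun [set: T] (fun w => f (X w)).
Proof.
move=> mX cf.
pose K m w : {ffun I -> int} := [ffun i => Num.floor (m.+1%:R * X w i)].
pose G m (k : {ffun I -> int}) : {ptws I -> R} := fun i => (k i)%:~R / m.+1%:R.
apply: (@measurable_fun_cvg _ _ _ _ (fun m w => f (G m (K m w)))).
  move=> m _ B mB; rewrite setTI.
  rewrite [X in measurable X](_ : _ = \bigcup_(k : {ffun I -> int})
     (if f (G m k) \in B then [set w | K m w = k] else set0)); last first.
    apply/seteqP; split=> [w /= Bw|w /= [k _]].
      by exists (K m w) => //; rewrite mem_set.
    by case: ifPn => // /set_mem Bk /= ->.
  apply: countable_bigcupT_measurable => // k; case: ifP => // _.
  rewrite (_ : [set w | _] = \big[setI/setT]_(i : I)
      [set w | (k i)%:~R <= m.+1%:R * X w i < (k i + 1)%:~R]).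
    apply: bigsetI_measurable => i _.
    rewrite (_ : [set w | _] =
       (fun w => m.+1%:R * X w i) @^-1` `[(k i)%:~R, (k i + 1)%:~R[%classic).
      rewrite -[X in measurable X]setTI.
      by apply: (measurable_funM (measurable_cst _) (mX i)).
    by apply/seteqP; split=> w /=; rewrite in_itv.
  apply/seteqP; split=> w /=.
    move=> <-; rewrite -bigcap_seq => i _ /=; rewrite ffunE.
    by rewrite Num.Theory.ge_floor Num.Theory.floorD1_gt.
  rewrite -bigcap_seq => h; apply/ffunP => i; rewrite ffunE.
  by apply/Num.Theory.floor_def; apply: h => /=; rewrite mem_index_enum.
move=> w _; apply: (@cvg_comp _ _ _ (fun m => G m (K m w)) f) (cf (X w)).
apply/cvg_sup => i; apply/cvg_image.
  by apply/seteqP; split=> // r _; exists (fun=> r).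
apply: (@cvg_trans _ ((G m (K m w) i) @[m --> \oo])).
  move=> A FA; exists ((fun g : {ptws I -> R} => g i) @^-1` A) => //.
  by apply/seteqP; split=> [_ [g Ag <-]//|r Ar]; exists (fun=> r).
apply/cvgrPdist_le => /= e e0; near=> m.
rewrite /G /K ffunE.
have m0 : 0 < m.+1%:R :> R by rewrite ltr0n.
rewrite -[X in `|X - _|](mulfK (lt0r_neq0 m0)) -mulrBl normrM normfV (gtr0_norm m0).
rewrite ler_pdivrMr//.
apply: (@le_trans _ _ 1).
  have := Num.Theory.floor_itv (m.+1%:R * X w i).
  rewrite intrD mulrC => /andP[? ?]. by rewrite ler_norml; lra.
rewrite -ler_pdivrMl// mulr1; near: m.
have [M _ HM] := near_infty_natSinv_lt (PosNum e0).
exists M => // m /HM /= /ltW; rewrite invf_ple ?posrE//.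
Unshelve. all: by end_near. Qed.

(** * Densities concentrating at a point *)
Lemma dominated_convergence_pinfty d (S : measurableType d) (R : realType)
    (mu : {measure set S -> \bar R}) (b0 : R) (F : R -> S -> R) (f G : S -> R) :
  (forall b, b0 <= b -> measurable_fun [set: S] (F b)) ->
  measurable_fun [set: S] f -> mu.-integrable setT (EFin \o G) ->
  (forall b s, b0 <= b -> `|F b s| <= G s) ->
  (forall s, F b s @[b --> +oo] --> f s) ->
  (\int[mu]_s (F b s)%:E)%E @[b --> +oo] --> (\int[mu]_s (f s)%:E)%E.
Proof.
move=> mF mf iG FG Ff; apply/cvge_pinftyP => u uoo.
have [N _ HN] := (cvgryPge u).1 uoo b0.
rewrite -(cvg_shiftn N).
have uN n : b0 <= u (n + N)%N by apply: HN => /=; exact: leq_addl.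
have [|||||//] := @dominated_convergence _ _ _ mu _ measurableT
  (fun n s => (F (u (n + N)%N) s)%:E) (EFin \o f) (EFin \o G).
- by move=> n; apply/measurable_EFinP; exact: mF.
- exact/measurable_EFinP.
- apply: aeW => s _; apply: cvg_EFin; first exact: nearW.
  have := (cvg_pinftyP _ _).1 (Ff s) _ uoo.
  by rewrite -(cvg_shiftn N).
- exact: iG.
- by apply: aeW => s n _; rewrite /= lee_fin FG.
Qed.

Definition unzoom (R : realType) n (y : n.-tuple R) (s : R) (u : n.-tuple R) :
    n.-tuple R :=
  [tuple s * (tnth u i - tnth y i) | i < n].
Arguments unzoom {R n} y s u.

Lemma zoomK (R : realType) n (y : n.-tuple R) s : s != 0 ->
  cancel (zoom y s) (unzoom y s).
Proof.
move=> s0 t; apply: eq_from_tnth => i; rewrite !tnth_mktuple.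
by rewrite addrAC subrr add0r mulrC divfK.
Qed.

Lemma measurable_unzoom (R : realType) n (y : n.-tuple R) s :
  measurable_fun [set: n.-tuple R] (unzoom y s).
Proof.
apply/measurable_fun_tnthP => i.
rewrite (_ : _ \o _ = fun u => s * (tnth u i - tnth y i)); last first.
  by apply/funext => t /=; rewrite tnth_mktuple.
apply: measurable_funM => //; apply: measurable_funB => //.
exact: measurable_tnth.
Qed.

(** The law of the rescaled variable has density w (zoom y s t), up to a constant.
    The constant C does not depend on F, so that it can be computed from F = 1
    and never has to be known. *)
Lemma integral_unzoom_density d (T : measurableType d) (R : realType)
    (P : probability T R) n (U : T -> n.-tuple R) (w : n.-tuple R -> R)
    (y : n.-tuple R) (s c r : R) :
  measurable_fun [set: T] U -> measurable_fun [set: n.-tuple R] w ->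
  (forall t, 0 <= w t) -> 0 < s -> 0 < c -> 0 < r ->
  (forall A : set (n.-tuple R), measurable A -> P [set x | A (U x)] =
     \int[lebesgue_tuple n]_(t in A) (c * w t)%:E)%E ->
  exists2 C : R, 0 < C &
  forall F : n.-tuple R -> R,
    measurable_fun [set: n.-tuple R] F -> (forall t, 0 <= F t) ->
    (\int[P]_x (F (unzoom y s (U x)))%:E =
     C%:E * \int[lebesgue_tuple n]_t (F t * (w (zoom y s t) / r))%:E)%E.
Proof.
move=> mU mw w0 s0 c0 r0 Pw; exists (c * r / s ^+ n).
  by rewrite !mulr_gt0// ?invr_gt0 ?exprn_gt0.
move=> F mF F0.
have mFu : measurable_fun [set: n.-tuple R] (fun u => (F (unzoom y s u))%:E).
  apply/measurable_EFinP; apply: measurableT_comp => //.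
  exact: measurable_unzoom.
have mcw : measurable_fun [set: n.-tuple R] (fun t => c * w t).
  exact: measurable_funM.
have cw0 u : 0 <= c * w u by rewrite mulr_ge0// ltW.
have Fu0 u : (0 <= (F (unzoom y s u))%:E)%E by rewrite lee_fin.
rewrite (@ge0_integral_density _ _ T (n.-tuple (measurableTypeR R)) R P
  (lebesgue_tuple n) U _ mU mcw cw0 Pw _ mFu Fu0).
pose H u := ((F (unzoom y s u))%:E * (c * w u)%:E)%E.
have mH : measurable_fun [set: n.-tuple R] H.
  by apply: emeasurable_funM => //; exact/measurable_EFinP.
have H0 u : (0 <= H u)%E by rewrite mule_ge0// lee_fin// mulr_ge0// ltW.
have := ge0_integral_zoom _ _ H y _ s0 mH H0.
have sn0 : 0 < s ^+ n by rewrite exprn_gt0.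
move=> /(congr1 (fun x => (s ^+ n)^-1%:E * x)%E).
rewrite muleA -EFinM mulVf ?gt_eqF// mul1e => <-.
have mHz : measurable_fun [set: n.-tuple R] (fun t => H (zoom y s t)).
  by apply: measurableT_comp => //; exact: measurable_zoom.
have mw' : measurable_fun [set: n.-tuple R] (fun t => w (zoom y s t) / r).
  apply: measurable_funM => //.
  by apply: measurableT_comp => //; exact: measurable_zoom.
have mFw : measurable_fun [set: n.-tuple R]
    (fun t => (F t * (w (zoom y s t) / r))%:E).
  by apply/measurable_EFinP; exact: measurable_funM.
have Fw0 t : (0 <= (F t * (w (zoom y s t) / r))%:E)%E.
  by rewrite lee_fin mulr_ge0// mulr_ge0// invr_ge0 ltW.
have si0 : (0 <= (s ^+ n)^-1%:E)%E by rewrite lee_fin invr_ge0 ltW.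
have C0 : (0 <= (c * r / s ^+ n)%:E)%E.
  by rewrite lee_fin !mulr_ge0// ?invr_ge0 ltW.
rewrite -(ge0_integralZl (lebesgue_tuple n) measurableT mHz (fun t _ => H0 _) si0).
rewrite -(ge0_integralZl (lebesgue_tuple n) measurableT mFw (fun t _ => Fw0 t) C0).
apply: eq_integral => t _; rewrite /H zoomK ?gt_eqF// -!EFinM; congr EFin.
by field; rewrite !gt_eqF.
Qed.

(** Laplace's method for probability densities known up to normalization. If the
    rescaled unnormalized densities, divided by a reference value r, are dominated
    by an integrable function and converge pointwise to g, then the rescaled
    variables have the limit density proportional to g: dominated convergence
    applies to the integrals of F and of 1, and expectations are their
    quotients. Letting F depend on b covers convergence in probability, for which
    F is the indicator of a set that moves to infinity. *)
Lemma cvg_rescaled_expectation (R : realType) n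
    (d : R -> measure_display) (T : forall b, measurableType (d b))
    (P : forall b, probability (T b) R) (U : forall b, T b -> n.-tuple R)
    (w : R -> n.-tuple R -> R) (y : n.-tuple R) (r : R -> R)
    (d0 : measure_display) (T0 : measurableType d0) (P0 : probability T0 R)
    (U0 : T0 -> n.-tuple R) (g G : n.-tuple R -> R) (c0 b0 : R) :
  0 < b0 -> 0 < c0 ->
  (forall b, b0 <= b ->
    [/\ measurable_fun [set: T b] (U b),
        measurable_fun [set: n.-tuple R] (w b),
        forall t, 0 <= w b t, 0 < r b &
        exists2 c : R, 0 < c & forall A : set (n.-tuple R), measurable A ->
          (P b [set x | A (U b x)] =
           \int[lebesgue_tuple n]_(t in A) (c * w b t)%:E)%E]) ->
  measurable_fun [set: T0] U0 -> measurable_fun [set: n.-tuple R] g ->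
  (forall t, 0 <= g t) ->
  (forall A : set (n.-tuple R), measurable A ->
    (P0 [set x | A (U0 x)] =
     \int[lebesgue_tuple n]_(t in A) (c0 * g t)%:E)%E) ->
  (lebesgue_tuple n).-integrable setT (EFin \o G) ->
  (forall b t, b0 <= b -> w b (zoom y (Num.sqrt b) t) / r b <= G t) ->
  (forall t, w b (zoom y (Num.sqrt b) t) / r b @[b --> +oo] --> g t) ->
  forall (F : R -> n.-tuple R -> R) (Finf : n.-tuple R -> R) (M : R),
  (forall b, b0 <= b -> measurable_fun [set: n.-tuple R] (F b)) ->
  measurable_fun [set: n.-tuple R] Finf ->
  (forall b t, b0 <= b -> 0 <= F b t <= M) -> (forall t, 0 <= Finf t) ->
  (forall t, F b t @[b --> +oo] --> Finf t) ->
  (\int[P b]_x (F b (unzoom y (Num.sqrt b) (U b x)))%:E)%E @[b --> +oo]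
    --> (\int[P0]_x (Finf (U0 x))%:E)%E.
Proof.
move=> b0_gt0 c0_gt0 HP mU0 mg g_ge0 P0g iG wG wg.
pose wz b t := w b (zoom y (Num.sqrt b) t) / r b.
have mwz b : b0 <= b -> measurable_fun [set: n.-tuple R] (wz b).
  move=> /HP[_ mw _ _ _]; apply: measurable_funM => //.
  by apply: measurableT_comp => //; exact: measurable_zoom.
have wz0 b t : b0 <= b -> 0 <= wz b t.
  by move=> /HP[_ _ w0 r0 _]; rewrite divr_ge0// ltW.
pose I (f : n.-tuple R -> R) := (\int[lebesgue_tuple n]_t (f t)%:E)%E.
have cvgI (F : R -> n.-tuple R -> R) (Finf : n.-tuple R -> R) (M : R) :
    (forall b, b0 <= b -> measurable_fun [set: n.-tuple R] (F b)) ->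
    measurable_fun [set: n.-tuple R] Finf ->
    (forall b t, b0 <= b -> 0 <= F b t <= M) ->
    (forall t, F b t @[b --> +oo] --> Finf t) ->
    I (fun t => F b t * wz b t) @[b --> +oo] --> I (fun t => Finf t * g t).
  move=> mF mFinf F0M FF.
  apply: (@dominated_convergence_pinfty _ (n.-tuple (measurableTypeR R)) R
    (lebesgue_tuple n) b0 _ _ (fun t => M * G t)).
  - by move=> b bb; apply: measurable_funM; [exact: mF|exact: mwz].
  - exact: measurable_funM.
  - rewrite (_ : _ \o _ = (fun t => M%:E * (EFin \o G) t)%E)//.
    exact: integrableZl.
  - move=> b t bb; have /andP[F0 FM] := F0M b t bb.
    rewrite ger0_norm; last by rewrite mulr_ge0// wz0.
    by apply: ler_pM => //; [exact: wz0|exact: wG].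
  - by move=> t; apply: cvgM; [exact: FF|exact: wg].
have E0 (f : n.-tuple R -> R) : measurable_fun [set: n.-tuple R] f -> (forall t, 0 <= f t) ->
    (\int[P0]_x (f (U0 x))%:E = c0%:E * I (fun t => (f t * g t)%R))%E.
  move=> mf f0.
  have mcg : measurable_fun [set: n.-tuple R] (fun t => c0 * g t).
    exact: measurable_funM.
  have mf' : measurable_fun [set: n.-tuple R] (EFin \o f) by exact/measurable_EFinP.
  have cg0 t : 0 <= c0 * g t by rewrite mulr_ge0// ltW.
  have f0' t : (0 <= (EFin \o f) t)%E by rewrite lee_fin.
  rewrite (@ge0_integral_density _ _ T0 (n.-tuple (measurableTypeR R)) R P0
    (lebesgue_tuple n) U0 _ mU0 mcg cg0 P0g (EFin \o f) mf' f0').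
  have mfg : measurable_fun [set: n.-tuple R] (fun t => (f t * g t)%:E).
    by apply/measurable_EFinP; exact: measurable_funM.
  have fg0 t : (0 <= (f t * g t)%:E)%E by rewrite lee_fin mulr_ge0.
  have c0_ge0 : (0 <= c0%:E)%E by rewrite lee_fin ltW.
  rewrite -(ge0_integralZl (lebesgue_tuple n) measurableT mfg (fun t _ => fg0 t) c0_ge0).
  by apply: eq_integral => t _; rewrite /= -!EFinM mulrCA.
have one_prob dd (TT : measurableType dd) (PP : probability TT R) :
    (\int[PP]_x 1%:E = 1)%E.
  by rewrite integral_cst//= probability_setT mule1.
have Ib b : b0 <= b -> exists2 C : R, I (wz b) = (C^-1)%:E &
    forall f : n.-tuple R -> R, measurable_fun [set: n.-tuple R] f -> (forall t, 0 <= f t) ->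
    (\int[P b]_x (f (unzoom y (Num.sqrt b) (U b x)))%:E =
     C%:E * I (fun t => (f t * wz b t)%R))%E.
  move=> bb; have [mU mw w0 r0 [c c_gt0 Pw]] := HP b bb.
  have sb : 0 < Num.sqrt b by rewrite sqrtr_gt0 (lt_le_trans b0_gt0).
  have [C C0 HC] := integral_unzoom_density _ _ _ _ _ _ _ y _ _ _
    mU mw w0 sb c_gt0 r0 Pw.
  exists C => //.
  have := HC (fun=> 1) (measurable_cst _) (fun=> ler01).
  rewrite one_prob /I; under eq_integral do rewrite mul1r.
  move=> /(congr1 (fun x => C^-1%:E * x)%E).
  by rewrite mule1 muleA -EFinM mulVf ?gt_eqF// mul1e => <-.
have Ig : I g = (c0^-1)%:E.
  have := E0 (fun=> 1) (measurable_cst _) (fun=> ler01).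
  rewrite one_prob /I; under eq_integral do rewrite mul1r.
  move=> /(congr1 (fun x => c0^-1%:E * x)%E).
  by rewrite mule1 muleA -EFinM mulVf ?gt_eqF// mul1e => <-.
have cvg_norm : I (wz b) @[b --> +oo] --> (c0^-1)%:E.
  rewrite -Ig.
  have I1 f : I (fun t => 1 * f t) = I f.
    by apply: eq_integral => t _; rewrite mul1r.
  rewrite -(I1 g); under eq_fun do rewrite -I1.
  apply: (cvgI (fun _ _ => 1) (fun=> 1) 1) => // [b t _|t].
    by rewrite ler01 lexx.
  exact: cvg_cst.
move=> F Finf M mF mFinf F0M Finf0 FF.
rewrite E0//.
have near_b0 : \forall b \near +oo, b0 <= b.
  by apply: nbhs_pinfty_ge; exact: num_real.
apply: (@cvg_trans _ ((((fine (I (wz b)))^-1)%:E *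
    I (fun t => (F b t * wz b t)%R))%E @[b --> +oo])).
  apply: near_eq_cvg; near=> b.
  have bb : b0 <= b by near: b.
  have [C IC ->] := Ib b bb; first by rewrite IC /= invrK.
    exact: mF.
  by move=> t; have /andP[] := F0M b t bb.
apply: cvgeM; last exact: (cvgI _ _ M).
  by rewrite /mule_def; case: (I _) => // *; rewrite gt_eqF.
apply: cvg_EFin; first by apply: nearW.
rewrite -[c0]invrK; apply: cvgV; first by rewrite invr_eq0 gt_eqF.
exact: fine_cvg.
Unshelve. all: by end_near. Qed.

(** * Arrays and tuples of their lower rows *)
Lemma assemble_lower (R : realType) N (top : N.-tuple R)
    (t : #|{: cell N}|.-tuple R) k (kN : (k < N)%N) (i : 'I_k) :
  assemble top t i =
  tnth t (enum_rank (Tagged (fun l : 'I_N => 'I_l) (i : 'I_(Ordinal kN)))).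
Proof.
rewrite /assemble; case: {-}_ / idP => [kN'|//].
by rewrite (bool_irrelevance kN' kN).
Qed.

Lemma assemble_top (R : realType) N (top : N.-tuple R)
    (t : #|{: cell N}|.-tuple R) (i : 'I_N) :
  assemble top t i = tnth top i.
Proof.
rewrite /assemble; case: {-}_ / idP => [kN'|_]; last by rewrite -tnth_nth.
by exfalso; rewrite ltnn in kN'.
Qed.

Lemma tnth_lower_rows (R : realType) N (y : array R) (c : cell N) :
  tnth (lower_rows N y) (enum_rank c) = y (tag c) (tagged c).
Proof. by rewrite tnth_mktuple enum_rankK. Qed.

Lemma tnth_nseq0 (R : realType) N (i : 'I_N) :
  tnth [tuple of nseq N (0 : R)] i = 0.
Proof. by rewrite (tnth_nth 0) nth_nseq ltn_ord. Qed.

(** The array assembled with a zero top row is the displacement tau of the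
    expansion around y. *)
Lemma assemble_zoom (R : realType) N (z : N.-tuple R) (y : array R) s t :
  (forall i : 'I_N, y N i = tnth z i) ->
  forall k (i : 'I_k), (k <= N)%N ->
  assemble z (zoom (lower_rows N y) s t) i =
  y k i + assemble [tuple of nseq N 0] t i / s.
Proof.
move=> yN k i; rewrite leq_eqVlt => /predU1P[kN|kN].
  move: i; rewrite kN => i.
  by rewrite !assemble_top yN tnth_nseq0 mul0r addr0.
by rewrite !assemble_lower tnth_mktuple tnth_lower_rows.
Qed.

Lemma assemble_unzoom (R : realType) N (Y y : array R) s :
  (forall i : 'I_N, Y N i = y N i) ->
  forall k (i : 'I_k), (k <= N)%N ->
  assemble [tuple of nseq N 0] (unzoom (lower_rows N y) s (lower_rows N Y)) i =
  s * (Y k i - y k i).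
Proof.
move=> YN k i; rewrite leq_eqVlt => /predU1P[kN|kN].
  move: i; rewrite kN => i.
  by rewrite assemble_top tnth_nseq0 YN subrr mulr0.
by rewrite !assemble_lower tnth_mktuple !tnth_lower_rows.
Qed.

(** Row 0 is empty, so the rows 1 <= k < N list all the cells. *)
Lemma sum_assemble (R : realType) N (t : #|{: cell N}|.-tuple R) (f : R -> R) :
  \sum_(1 <= k < N) \sum_(i < k) f (assemble [tuple of nseq N 0] t i) =
  \sum_(j < #|{: cell N}|) f (tnth t j).
Proof.
transitivity (\sum_(k < N) \sum_(i < k) f (assemble [tuple of nseq N 0] t i)).
  rewrite -(big_mkord predT (fun k => \sum_(i < k) f (assemble [tuple of nseq N 0] t i))).
  case: N t => [|N] t; first by rewrite !big_geq.
  by rewrite [RHS]big_ltn// big_ord0 add0r.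
rewrite (sig_big_dep (fun k : 'I_N => true) (fun k _ => true)
  (fun k i => f (assemble [tuple of nseq N 0] t i)))/=.
rewrite (reindex (@enum_val _ {: cell N})) /=; last first.
  by exists enum_rank => c _; [exact: enum_valK|exact: enum_rankK].
apply: eq_bigr => j _; move: (enum_valK j); case: (enum_val j) => -[k kN] i <-.
by congr (f _); exact: (assemble_lower _ _ _ _ _ kN).
Qed.

Lemma measurable_assemble (R : realType) N (top : N.-tuple R) k (i : 'I_k) :
  measurable_fun [set: #|{: cell N}|.-tuple R] (fun t => assemble top t i).
Proof.
have [kN|Nk] := ltnP k N.
  rewrite (_ : (fun t => _) = fun t => tnth t
      (enum_rank (Tagged (fun l : 'I_N => 'I_l) (i : 'I_(Ordinal kN))))).
    exact: measurable_tnth.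
  by apply/funext => t; exact: assemble_lower.
rewrite (_ : (fun t => _) = cst top`_i); first exact: measurable_cst.
apply/funext => t; rewrite /assemble; case: {-}_ / idP => // kN.
by exfalso; rewrite ltnNge Nk in kN.
Qed.

Lemma measurable_forallb d (T : measurableType d) (I : finType) (P : I -> T -> bool) :
  (forall i, measurable_fun [set: T] (P i)) ->
  measurable_fun [set: T] (fun x => [forall i, P i x]).
Proof.
move=> mP; apply: (measurable_fun_bool true).
rewrite setTI (_ : _ @^-1` _ = \big[setI/setT]_(i : I) (P i @^-1` [set true])).
  by apply: bigsetI_measurable => i _; rewrite -[X in measurable X]setTI; exact: mP.
apply/seteqP; split=> x /=.
  by move=> /forallP H; rewrite -bigcap_seq => i _; exact: H.
by rewrite -bigcap_seq => H; apply/forallP => i; apply: H; rewrite /= mem_index_enum.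
Qed.

Lemma measurable_nat_of_bool d (T : measurableType d) (R : realType) (P : T -> bool) :
  measurable_fun [set: T] P -> measurable_fun [set: T] (fun x => (P x)%:R : R).
Proof.
move=> mP; rewrite (_ : (fun x => _) = (fun x => if P x then 1 else 0)).
  exact: measurable_fun_ifT.
by apply/funext => x; case: (P x).
Qed.

Lemma measurable_prod_cond d (T : measurableType d) (R : realType) (I : eqType)
    (s : seq I) (P : pred I) (h : I -> T -> R) :
  (forall i, measurable_fun [set: T] (h i)) ->
  measurable_fun [set: T] (fun x => \prod_(i <- s | P i) h i x).
Proof.
move=> mh; under eq_fun do rewrite big_mkcond.
by apply: measurable_prod => i _; case: (P i).
Qed.

Lemma measurable_sum_cond d (T : measurableType d) (R : realType) (I : Type)
    (s : seq I) (P : pred I) (h : I -> T -> R) :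
  (forall i, measurable_fun [set: T] (h i)) ->
  measurable_fun [set: T] (fun x => \sum_(i <- s | P i) h i x).
Proof.
move=> mh; under eq_fun do rewrite big_mkcond.
by apply: measurable_sum => i; case: (P i).
Qed.

Lemma measurable_corners_weight (R : realType) N (a z : N.-tuple R) b :
  measurable_fun [set: #|{: cell N}|.-tuple R]
    (fun t => corners_weight a b (assemble z t)).
Proof.
have mA k (i : 'I_k) := @measurable_assemble R N z k i.
rewrite /corners_weight; apply: measurable_funM; first apply: measurable_funM.
- apply: measurable_nat_of_bool; apply: measurable_forallb => k.
  have [_|_] := boolP (0 < k)%N; last first.
    rewrite (_ : (fun t => _) = cst true); first exact: measurable_cst.
    exact/funext.
  rewrite (_ : (fun t => _) =
      (fun t => row_interlace (@assemble R N z t k) (@assemble R N z t k.+1))).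
    apply: measurable_forallb => i.
    by apply: measurable_and; apply: measurable_fun_ler; exact: mA.
  exact/funext.
- apply: measurable_prod => k _; apply: measurable_funM.
    apply: measurable_prod => i _.
    apply: measurable_prod_cond => j.
    apply: (measurableT_comp (measurable_powR _)).
    by apply: measurable_funB; exact: mA.
  apply: measurable_prod => p _; apply: measurable_prod => q _.
  apply: (measurableT_comp (measurable_powR _)).
  by apply: measurableT_comp => //; apply: measurable_funB; exact: mA.
apply: measurableT_comp => //; apply: measurable_sum => k; apply: measurable_sum => i.
by apply: measurable_funM => //; exact: mA.
Qed.

Lemma measurable_dgff_weight (R : realType) N (y : array R) :
  measurable_fun [set: #|{: cell N}|.-tuple R]
    (fun t => dgff_weight N y (assemble [tuple of nseq N 0] t)).
Proof.
have mA k (i : 'I_k) := @measurable_assemble R N [tuple of nseq N 0] k i.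
apply: measurableT_comp => //; apply: measurable_sum => k; apply: measurable_funB.
  apply: measurable_sum => i; apply: measurable_sum_cond => j.
  apply: measurable_funM => //; apply: measurable_funX.
  by apply: measurable_funB; exact: mA.
apply: measurable_sum => p; apply: measurable_sum => q.
apply: measurable_funM => //; apply: measurable_funX.
by apply: measurable_funB; exact: mA.
Qed.

Lemma measurable_lower_rows d (T : measurableType d) (R : realType) N
    (Y : T -> array R) :
  (forall k (i : 'I_k), (k <= N)%N -> measurable_fun [set: T] (fun x => Y x k i)) ->
  measurable_fun [set: T] (fun x => lower_rows N (Y x)).
Proof.
move=> mY; apply/measurable_fun_tnthP => j.
rewrite (_ : _ \o _ = fun x => Y x (tag (enum_val j)) (tagged (enum_val j))).
  by apply: mY; exact: ltnW.
by apply/funext => x /=; rewrite tnth_mktuple.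
Qed.

(** The integral factorizes into one-dimensional Gaussian integrals. *)
Lemma integrable_gauss_tuple (R : realType) n (c K : R) : 0 < c ->
  (lebesgue_tuple n).-integrable [set: n.-tuple (measurableTypeR R)]
    (EFin \o (fun t : n.-tuple R => K * \prod_(j < n) expR (- (c * tnth t j ^+ 2)))).
Proof.
move=> c0; pose g (x : R) := expR (- (c * x ^+ 2)).
have mg : measurable_fun [set: R] g.
  apply: measurableT_comp => //; apply: measurableT_comp => //.
  by apply: measurable_funM => //; exact: measurable_funX.
have g0 x : 0 <= g x by exact: expR_ge0.
have sc : 0 < Num.sqrt c by rewrite sqrtr_gt0.
have intg : (\int[lebesgue_measure]_x (g x)%:E < +oo)%E.
  have -> : (\int[lebesgue_measure]_x (g x)%:E =
     \int[lebesgue_measure]_x (gauss_fun (0 + x / (Num.sqrt c)^-1))%:E)%E.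
    apply: eq_integral => x _; congr EFin; rewrite /g /gauss_fun add0r invrK.
    by rewrite exprMn sqr_sqrtr ?ltW// mulrC.
  rewrite (@ge0_integral_affine R (EFin \o gauss_fun) 0)//=.
  - by rewrite integralT_gauss -EFinM ltry.
  - by rewrite invr_gt0.
  - by apply/measurable_EFinP; exact: measurable_gauss_fun.
  - by move=> x; rewrite lee_fin gauss_fun_ge0.
have mG : measurable_fun [set: n.-tuple R] (fun t => \prod_(j < n) g (tnth t j)).
  apply: measurable_prod => j _; apply: measurableT_comp => //.
  exact: measurable_tnth.
rewrite (_ : _ \o _ = (fun t => K%:E * (\prod_(j < n) g (tnth t j))%:E)%E)//.
apply: integrableZl => //; apply/integrableP; split.
  exact/measurable_EFinP.
rewrite (_ : (fun x => _) = (fun t => (\prod_(j < n) g (tnth t j))%:E)); last first.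
  by apply/funext => t; rewrite /= ger0_norm// prodr_ge0.
rewrite integral_prod_tuple//.
have : (\int[lebesgue_measure]_x (g x)%:E)%E \is a fin_num.
  rewrite ge0_fin_numE//; apply: integral_ge0 => x _; by rewrite lee_fin.
by move=> /fineK <-; rewrite -EFin_expe ltry.
Qed.

(** * Convergence of the corners process *)

(** Both parts of the theorem come from here: F is an indicator function in the
    first one and a bounded continuous function, shifted to be nonnegative, in
    the second one. *)
Lemma cvg_corners_functional (R : realType) (N : nat) (z : N.-tuple R) (y : array R)
    (d0 : measure_display) (T0 : measurableType d0) (P0 : probability T0 R)
    (zeta : T0 -> array R) (a : N.-tuple R) (d : R -> measure_display)
    (T : forall beta : R, measurableType (d beta))
    (P : forall beta : R, probability (T beta) R)
    (Y : forall beta : R, T beta -> array R) :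
  (1 <= N)%N ->
  (forall i j : 'I_N, (i < j)%N -> tnth z j < tnth z i) ->
  infty_corners_lattice z y ->
  dgff P0 N y zeta ->
  (forall beta : R, 0 < beta -> perturbed_corners (P beta) z a beta (Y beta)) ->
  forall (F : R -> #|{: cell N}|.-tuple R -> R) (Finf : #|{: cell N}|.-tuple R -> R) (M : R),
  (forall b, 4 <= b -> measurable_fun [set: #|{: cell N}|.-tuple R] (F b)) ->
  measurable_fun [set: #|{: cell N}|.-tuple R] Finf ->
  (forall b t, 4 <= b -> 0 <= F b t <= M) -> (forall t, 0 <= Finf t) ->
  (forall t, F b t @[b --> +oo] --> Finf t) ->
  (\int[P b]_x (F b (unzoom (lower_rows N y) (Num.sqrt b)
                      (lower_rows N (Y b x))))%:E)%E @[b --> +oo]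
    --> (\int[P0]_x (Finf (lower_rows N (zeta x)))%:E)%E.
Proof.
move=> N1 z_decr lat [mzeta zetaN [c0 c0_gt0 zetaP]] HY.
have [yN _] := lat.
have cy : critical N y by exact: infty_corners_critical z_decr lat.
have [c c_gt0 [K HK]] := corners_ratio_le _ _ a _ N1 cy.
pose tau t : array R := @assemble R N [tuple of nseq N 0] t.
have tauN t i : tau t N i = 0 by rewrite /tau assemble_top tnth_nseq0.
apply: (@cvg_rescaled_expectation R _ d T P (fun b x => lower_rows N (Y b x))
  (fun b t => corners_weight a b (assemble z t)) (lower_rows N y)
  (fun b => corners_weight a b y) d0 T0 P0 (fun x => lower_rows N (zeta x))
  (fun t => dgff_weight N y (tau t))
  (fun t => K * \prod_(j < #|{: cell N}|) expR (- (c * tnth t j ^+ 2))) c0 4) => //.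
- move=> b b4; have b0 : 0 < b by lra.
  have [mY YN [cb cb0 Pb]] := HY b b0; split.
  + exact: measurable_lower_rows.
  + exact: measurable_corners_weight.
  + move=> t; rewrite /corners_weight mulr_ge0 ?expR_ge0// mulr_ge0//.
    apply: prodr_ge0 => k _; apply: mulr_ge0.
      by apply: prodr_ge0 => i _; apply: prodr_ge0 => j _; exact: powR_ge0.
    by apply: prodr_ge0 => i _; apply: prodr_ge0 => j _; exact: powR_ge0.
  + by apply: corners_weight_critical_gt0 => //; lra.
  + by exists cb.
- exact: measurable_lower_rows.
- exact: measurable_dgff_weight.
- by move=> t; exact: expR_ge0.
- exact: integrable_gauss_tuple.
- move=> b t b4; have b0 : 0 < b by lra.
  have sb : Num.sqrt b != 0 by rewrite gt_eqF// sqrtr_gt0.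
  apply: (le_trans (HK b _ b4 _)) => [i|]; first by rewrite assemble_top yN.
  rewrite le_eqVlt; apply/orP; left; apply/eqP; congr (_ * _).
  rewrite -expR_sum; congr expR; rewrite sumrN -mulr_sumr; congr (- (_ * _)).
  rewrite -(sum_assemble _ _ t (fun x => x ^+ 2)) mulr_sumr.
  rewrite big_nat [RHS]big_nat; apply: eq_bigr => k /andP[_ kN].
  rewrite mulr_sumr; apply: eq_bigr => i _.
  rewrite (assemble_zoom _ _ _ _ _ _ yN _ _ (ltnW kN)) addrAC subrr add0r.
  by rewrite exprMn exprVn sqr_sqrtr ?ltW// mulrCA divff ?mulr1// gt_eqF.
- move=> t; apply: (@cvg_corners_ratio R N a y (tau t)
    (fun b => @assemble R N z (zoom (lower_rows N y) (Num.sqrt b) t))) => //.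
  by move=> b k i kN; exact: assemble_zoom.
Qed.

Lemma integral_shift d (T : measurableType d) (R : realType) (P : probability T R)
    (g : T -> R) M :
  measurable_fun [set: T] g -> (forall x, `|g x| <= M) ->
  (\int[P]_x (g x)%:E = \int[P]_x (g x + M)%R%:E - M%:E)%E.
Proof.
move=> mg gM.
have icst : P.-integrable setT (EFin \o cst M) by exact: finite_measure_integrable_cst.
have ig : P.-integrable setT (EFin \o g).
  apply: le_integrable icst => //; first exact/measurable_EFinP.
  by move=> x _; rewrite /= lee_fin (le_trans (gM x))// ler_norm.
under [X in _ = (X - _)%E]eq_integral do rewrite EFinD.
rewrite integralD//= integral_cst//= probability_setT mule1 addeK//.
Qed.

Theorem theorem4p6 (R : realType) (N : nat) (z : N.-tuple R) (y : array R)
    (d0 : measure_display) (T0 : measurableType d0) (P0 : probability T0 R)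
    (zeta : T0 -> array R) (a : N.-tuple R) (d : R -> measure_display)
    (T : forall beta : R, measurableType (d beta))
    (P : forall beta : R, probability (T beta) R)
    (Y : forall beta : R, T beta -> array R) :
  (1 <= N)%N ->
  (forall i j : 'I_N, (i < j)%N -> tnth z j < tnth z i) ->
  infty_corners_lattice z y ->
  dgff P0 N y zeta ->
  (forall beta : R, 0 < beta -> perturbed_corners (P beta) z a beta (Y beta)) ->
  (forall (k : nat) (i : 'I_k), (k <= N)%N ->
     cvg_in_probability P (fun beta x => Y beta x k i) (y k i)) /\
  cvg_in_distribution P
    (fun beta x =>
       array_cells N.+1 (fun k i => Num.sqrt beta * (Y beta x k i - y k i)))
    P0 (fun x => array_cells N.+1 (zeta x)).
Proof.
move=> N1 z_decr lat Hzeta HY.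
have main := @cvg_corners_functional R N z y d0 T0 P0 zeta a d T P Y
  N1 z_decr lat Hzeta HY.
have [yN _] := lat.
have YN b x (i : 'I_N) : 0 < b -> Y b x N i = y N i.
  by move=> b0; have [_ -> _] := HY b b0; rewrite yN.
have near4 : \forall b \near +oo, (4 : R) <= b.
  by apply: nbhs_pinfty_ge; exact: num_real.
split=> [k i|].
  rewrite leq_eqVlt => /predU1P[kN|kN] eps eps0.
    move: i; rewrite kN => i.
    apply: cvg_near_cst; apply: filterS near4 => b b4.
    rewrite (_ : [set x | _] = set0) ?measure0//.
    apply/seteqP; split=> // x /=; rewrite YN ?subrr ?normr0; last by lra.
    by rewrite leNgt eps0.
  pose j := enum_rank (Tagged (fun l : 'I_N => 'I_l) (i : 'I_(Ordinal kN))).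
  pose F (b : R) (t : #|{: cell N}|.-tuple R) : R :=
    (eps * Num.sqrt b <= `|tnth t j|)%R%:R.
  have mF b : measurable_fun [set: #|{: cell N}|.-tuple R] (F b).
    apply: measurable_nat_of_bool; apply: measurable_fun_ler => //.
    by apply: measurableT_comp => //; exact: measurable_tnth.
  have F01 b t : 4 <= b -> 0 <= F b t <= 1.
    by move=> _; rewrite /F; case: (eps * _ <= _); rewrite ?lexx ?ler01.
  have F0 t : F b t @[b --> +oo] --> (0 : R).
    apply: cvg_near_cst.
    apply: filterS ((cvgryPgt _).1 (@cvg_sqrt_pinfty R) (eps^-1 * `|tnth t j|)) => b.
    rewrite ltr_pdivrMl// => lt_t.
    by rewrite /F leNgt lt_t.
  have := main F (fun=> 0) 1 (fun b _ => mF b) (measurable_cst _) F01 (fun=> lexx _) F0.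
  rewrite integral0; apply: cvg_trans; apply: near_eq_cvg.
  apply: filterS near4 => b b4; have b0 : 0 < b by lra.
  have sb : 0 < Num.sqrt b by rewrite sqrtr_gt0.
  have [mY _ _] := HY b b0.
  have mA : measurable [set x | eps <= `|Y b x k i - y k i|].
    rewrite -[X in measurable X]setTI.
    apply: measurable_fun_le => //; apply: measurableT_comp => //.
    by apply: measurable_funB => //; apply: mY; exact: ltnW.
  suff -> : P b [set x | eps <= `|Y b x k i - y k i|] =
      (\int[P b]_x (F b (unzoom (lower_rows N y) (Num.sqrt b)
         (lower_rows N (Y b x))))%:E)%E by [].
  rewrite -[in LHS](setIT [set x | _]) -integral_indic//.
  apply: eq_integral => x _; rewrite indicE /F tnth_mktuple !tnth_lower_rows/=.
  rewrite normrM (gtr0_norm sb) mulrC ler_pM2l//.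
  rewrite (_ : (x \in _) = (eps <= `|Y b x k i - y k i|))//.
  by apply/idP/idP; rewrite inE.
move=> f cf [M fM].
pose phi (t : #|{: cell N}|.-tuple R) : R :=
  f (array_cells N.+1 (@assemble R N [tuple of nseq N 0] t)).
have mphi : measurable_fun [set: #|{: cell N}|.-tuple R] phi.
  apply: (@measurable_continuous_ptws _ _ _ _ (fun t => array_cells N.+1 _)) => //.
  by move=> c; exact: measurable_assemble.
have Hlim := main (fun _ t => phi t + M) (fun t => phi t + M) (2 * M).
have phiE b x : 4 <= b -> f (array_cells N.+1
    (fun k i => Num.sqrt b * (Y b x k i - y k i))) =
    phi (unzoom (lower_rows N y) (Num.sqrt b) (lower_rows N (Y b x))).
  move=> b4; congr f; apply/funext => -[k i]; rewrite /array_cells/=.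
  rewrite assemble_unzoom//; last by rewrite -ltnS.
  by move=> i'; apply: YN; lra.
have [mzeta zetaN _] := Hzeta.
have phiE0 x : f (array_cells N.+1 (zeta x)) = phi (lower_rows N (zeta x)).
  congr f; apply/funext => -[[k kN] i]; rewrite /array_cells/=.
  have kN' : (k <= N)%N := kN; move: (i : 'I_k) => {kN}i.
  move: kN'; rewrite leq_eqVlt => /predU1P[kN|kN].
    by move: i; rewrite kN => i; rewrite zetaN assemble_top.
  by rewrite (assemble_lower _ _ _ _ _ kN) tnth_lower_rows.
have phiM t : `|phi t| <= M by exact: fM.
have mphiM : measurable_fun [set: #|{: cell N}|.-tuple R] (fun t => phi t + M).
  exact: measurable_funD.
have phiM0 t : 0 <= phi t + M.
  by have := phiM t; rewrite ler_norml => /andP[? _]; lra.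
have phiM2 t : 0 <= phi t + M <= 2 * M.
  by rewrite phiM0/=; have := phiM t; rewrite ler_norml => /andP[_ ?]; lra.
have cphi t : phi t + M @[_ --> (+oo : set_system R)] --> phi t + M.
  exact: cvg_cst.
have {}Hlim := Hlim (fun _ _ => mphiM) mphiM (fun _ t _ => phiM2 t) phiM0 cphi.
have -> : 'E_P0[f \o (fun x => array_cells N.+1 (zeta x))]%E =
    (\int[P0]_x (phi (lower_rows N (zeta x)) + M)%R%:E - M%:E)%E.
  rewrite expectation.unlock; under eq_integral do rewrite /= phiE0.
  rewrite -integral_shift//.
  by apply: measurableT_comp => //; exact: measurable_lower_rows.
have Hsub := cvgeB (fin_num_adde_defl _ (erefl : (- M%:E)%E \is a fin_num))
  Hlim (cvg_cst M%:E).
apply: cvg_trans (near_eq_cvg _) (Hsub _ _).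
apply: filterS near4 => b b4; have b0 : 0 < b by lra.
have [mY _ _] := HY b b0.
rewrite expectation.unlock; under [RHS]eq_integral do rewrite /= phiE//.
rewrite -integral_shift//.
apply: measurableT_comp => //; apply: measurableT_comp; first exact: measurable_unzoom.
exact: measurable_lower_rows.
Qed.
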